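(* Let $n\ge 1$ be an integer and let $k,a,m\in\mathbb{C}$ with $a\neq 0$ and $\operatorname{Im}(m)\ge 0$, such that all terms occurring below are defined. Then $$\sum_{p=0}^{n-1}\left(i3^{p+1}\right)^k e^{im3^p}\Big(\Phi\big(e^{2i3^{p+1}m},-k,\tfrac16(1-i3^{-p}\log(a))\big)+e^{4im3^p}\,\Phi\big(e^{2i3^{p+1}m},-k,\tfrac16(5-i3^{-p}\log(a))\big)\Big)$$ $$=i^k e^{im}\,\Phi\big(e^{2im},-k,\tfrac12-\tfrac12 i\log(a)\big)-\left(i3^n\right)^k e^{im3^n}\,\Phi\big(e^{2i3^nm},-k,\tfrac12-\tfrac12 i3^{-n}\log(a)\big).$$
   Context: $\Phi(z,s,v)$ is the Hurwitz-Lerch zeta function: for $v\in\mathbb{C}\setminus\{0,-1,-2,\dots\}$, $\Phi(z,s,v)=\sum_{j=0}^{\infty}(v+j)^{-s}z^{j}$, convergent for $|z|<1$ and all $s\in\mathbb{C}$, and also for $|z|=1$ when $\operatorname{Re}(s)>1$; for $|z|=1$ and other $s$ it is defined by analytic continuation in $s$ (for $z=1$ this is the Hurwitz zeta function, with $s=1$ excluded). For $\operatorname{Re}(v)>0$ it has the integral representation $\Phi(z,s,v)=\frac{1}{\Gamma(s)}\int_0^\infty\frac{t^{s-1}e^{-(v-1)t}}{e^t-z}\,dt$ when either $|z|\le 1$, $z\ne1$, $\operatorname{Re}(s)>0$, or $z=1$, $\operatorname{Re}(s)>1$. Here $i=\sqrt{-1}$, $\log$ is the principal logarithm, and all complex powers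 are principal values. ''All terms defined'' means that the third argument of each $\Phi$ is not in $\{0,-1,-2,\dots\}$ and that the case (first argument of $\Phi$ equal to $1$ and $k=-1$) does not occur. *)

(* Defs.v *)
From Stdlib Require Import Reals.
From Coquelicot Require Import Coquelicot.

Open Scope C_scope.

Definition Cexp (z : C) : C :=
  (exp (Re z) * cos (Im z), exp (Re z) * sin (Im z))%R.

(** Principal argument, in (-PI, PI]; the value at 0 is irrelevant. *)
Definition Carg (z : C) : R :=
  if Rle_dec 0 (Im z)
  then acos (Re z / Cmod z)
  else (- acos (Re z / Cmod z))%R.

Definition Clog (z : C) : C := (ln (Cmod z), Carg z).

(** Principal value of z ^ w; meaningful only for z <> 0. *)
Definition Cpower (z w : C) : C := Cexp (w * Clog z).

(** F is the sum of a convergent power series on some disc around s0. *)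
Definition C_analytic_at (F : C -> C) (s0 : C) : Prop :=
  exists (c : nat -> C) (r : R), (0 < r)%R /\
    forall s : C, (Cmod (s - s0) < r)%R ->
      @is_pseries C_AbsRing C_NormedModule c (s - s0) (F s).

Definition lerch_term (z s v : C) (j : nat) : C :=
  Cpower (v + INR j) (- s) * z ^ j.

(** For |z| = 1: F is the analytic continuation of the Dirichlet-type series
    s |-> sum_j (v + j)^(-s) z^j from the half-plane Re s > 1 to the whole
    plane, with the point s = 1 removed when z = 1.  As the domain is connected,
    F is unique on it. *)
Definition is_lerch_continuation (z v : C) (F : C -> C) : Prop :=
  (forall s : C, (1 < Re s)%R ->
     @is_series C_AbsRing C_NormedModule (lerch_term z s v) (F s)) /\
  (forall s : C, ~ (z = 1 /\ s = 1) -> C_analytic_at F s).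

(** The Hurwitz-Lerch zeta function Phi(z, s, v), for |z| <= 1.
    [iota P] is the unique element satisfying [P] when there is one. *)
Definition HurwitzLerch (z s v : C) : C :=
  if Rlt_dec (Cmod z) 1
  then @iota C_CompleteNormedModule
         (fun w : C =>
            @is_series C_AbsRing C_NormedModule (lerch_term z s v) w)
  else @iota C_CompleteNormedModule
         (fun w : C =>
            exists F : C -> C, is_lerch_continuation z v F /\ w = F s).

(** Within |z| <= 1, the parameters at which Phi(z, s, v) is defined. *)
Definition HurwitzLerch_defined (z s v : C) : Prop :=
  (forall j : nat, v <> - INR j) /\ ~ (z = 1 /\ s = 1).

(* Main.v *)
Require Import Defs.
From Stdlib Require Import Reals Arith Lra Lia ClassicalEpsilon.
From Coquelicot Require Import Coquelicot.

(** A Lerch series splits according to the residue of the summation index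
    modulo 3.  Since [v + (3 j + r) = 3 ((v + r) / 3 + j)], this gives
    [Phi(z,s,v) = 3^(-s) (Phi(z^3,s,v/3) + z Phi(z^3,s,(v+1)/3)
    + z^2 Phi(z^3,s,(v+2)/3))] ([HurwitzLerch_trisection]).  Take
    [z = exp(2 i m 3^p)], [v = 1/2 - (i/2) 3^(-p) log a] and [s = -k]: the outer
    two terms are those of the p-th summand, and the middle one is the same
    expression with [p + 1] for [p].  Each summand is therefore a difference of
    consecutive values ([summand_telescopes]), and the sum telescopes.

    For [|z| < 1] the trisection is a rearrangement of an absolutely convergent
    series.  For [|z| = 1], that is, for real [m], the function is defined by
    analytic continuation in [s], and the trisection follows from its validity
    for [Re s > 1] by the identity theorem ([identity_halfplane]), once the
    continuation is known to exist ([lerch_continuation_exists]).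

    Existence is proved one vertical strip at a time.  The power
    [(v + j + 1)^(-s)] is expanded by Newton's binomial series in powers of
    [1 / (v + j)]; summing over [j] relates [(1 - z) Phi(z,s,v)] to the values
    [Phi(z,s+n,v)] with [n > 0] and to a remainder analytic further to the left
    ([lerch_difference_sum]).  If [z <> 1], dividing by [1 - z] gives the next
    strip ([strip_continuation_neq1]).  If [z = 1], the same relation at [s - 1]
    determines [(s - 1) Phi(1,s,v)], and the zeros of the binomial coefficients
    cancel the poles that the shifted terms would create
    ([strip_continuation_1]).

    Analyticity is controlled through the weighted l1 norm of the Taylor
    coefficients ([Wnorm_le]), for which products and convergent sums of analytic
    functions are again analytic by elementary means.  The one delicate estimate
    is the remainder of the binomial series, uniformly in [s]
    ([newton_expansion]): up to a Taylor remainder of the exponential it is a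
    polynomial in [s] which is small at 0, -1, -2, ..., where the series
    terminates, and interpolation bounds it everywhere. *)

Open Scope C_scope.

Local Notation Cseries := (@is_series C_AbsRing C_NormedModule).
Local Notation Csum := (@sum_n C_AbelianMonoid).
Local Notation Rsum := (@sum_n R_AbelianMonoid).

(** * Series of complex numbers *)

Lemma choose_function {A B : Type} (P : A -> B -> Prop) :
  (forall x, exists y, P x y) -> exists f, forall x, P x (f x).
Proof.
  intros H.
  exists (fun x => proj1_sig (constructive_indefinite_description _ (H x))).
  intros x. apply proj2_sig.
Qed.

Lemma Cseries_eps (a : nat -> C) (l : C) :
  Cseries a l <->
  forall eps : R, (0 < eps)%R ->
    exists N, forall n, (N <= n)%nat -> (Cmod (Csum a n - l) < eps)%R.
Proof.
  unfold is_series. split.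
  - intros H eps He.
    exact (proj1 (@filterlim_locally_ball_norm C_AbsRing _ C_NormedModule eventually
      _ (sum_n a) l) H (mkposreal eps He)).
  - intros H.
    exact (proj2 (@filterlim_locally_ball_norm C_AbsRing _ C_NormedModule eventually
      _ (sum_n a) l) (fun eps => H eps (cond_pos eps))).
Qed.

Lemma Cseries_unique (a : nat -> C) (l l' : C) :
  Cseries a l -> Cseries a l' -> l = l'.
Proof.
  intros H H'. exact (filterlim_locally_unique _ _ _ H H').
Qed.

Lemma Cseries_ext (a b : nat -> C) (l : C) :
  (forall n, a n = b n) -> Cseries a l -> Cseries b l.
Proof. apply is_series_ext. Qed.

Lemma Cseries_plus (a b : nat -> C) (la lb : C) :
  Cseries a la -> Cseries b lb -> Cseries (fun n => a n + b n) (la + lb).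
Proof. apply (@is_series_plus C_AbsRing C_NormedModule). Qed.

Lemma Cseries_scal (c : C) (a : nat -> C) (l : C) :
  Cseries a l -> Cseries (fun n => c * a n) (c * l).
Proof. apply (@is_series_scal_l C_AbsRing C_NormedModule). Qed.

Lemma Cseries_minus (a b : nat -> C) (la lb : C) :
  Cseries a la -> Cseries b lb -> Cseries (fun n => a n - b n) (la - lb).
Proof. apply (@is_series_minus C_AbsRing C_NormedModule). Qed.

Lemma Csum_S (a : nat -> C) n : Csum a (S n) = Csum a n + a (S n) :> C.
Proof. apply (@sum_Sn C_AbelianMonoid). Qed.

Lemma Csum_0 (a : nat -> C) : Csum a 0 = a 0%nat :> C.
Proof. apply (@sum_O C_AbelianMonoid). Qed.

Lemma Rsum_S (a : nat -> R) n : Rsum a (S n) = (Rsum a n + a (S n))%R :> R.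
Proof. apply (@sum_Sn R_AbelianMonoid). Qed.

Lemma Rsum_0 (a : nat -> R) : Rsum a 0 = a 0%nat :> R.
Proof. apply (@sum_O R_AbelianMonoid). Qed.

Lemma Csum_plus (a b : nat -> C) n :
  Csum (fun k => a k + b k) n = Csum a n + Csum b n :> C.
Proof. apply (@sum_n_plus C_AbelianMonoid). Qed.

Lemma Csum_scal (c : C) (a : nat -> C) n :
  Csum (fun k => c * a k) n = c * Csum a n :> C.
Proof. apply (@sum_n_mult_l C_Ring). Qed.

Lemma Csum_opp (a : nat -> C) n : Csum (fun k => - a k) n = - Csum a n :> C.
Proof.
  induction n as [|n IH]; rewrite ?Csum_S, ?Csum_0, ?IH; ring.
Qed.

Lemma Csum_ext (a b : nat -> C) n :
  (forall k, (k <= n)%nat -> a k = b k) -> Csum a n = Csum b n :> C.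
Proof. apply (@sum_n_ext_loc C_AbelianMonoid). Qed.

Lemma Rsum_le (a b : nat -> R) n :
  (forall k, (k <= n)%nat -> (a k <= b k)%R) -> (Rsum a n <= Rsum b n)%R.
Proof.
  induction n as [|n IH]; intros H; rewrite ?Rsum_S, ?Rsum_0.
  - apply H; lia.
  - apply Rplus_le_compat; [apply IH; intros; apply H; lia | apply H; lia].
Qed.

Lemma Rsum_mono (a : nat -> R) m n :
  (forall k, (0 <= a k)%R) -> (m <= n)%nat -> (Rsum a m <= Rsum a n)%R.
Proof.
  intros Ha H. induction H as [|n H IH]; [lra|].
  rewrite Rsum_S. specialize (Ha (S n)). lra.
Qed.

Lemma Rsum_term_le (a : nat -> R) k n :
  (forall k, (0 <= a k)%R) -> (k <= n)%nat -> (a k <= Rsum a n)%R.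
Proof.
  intros Ha H. apply Rle_trans with (Rsum a k); [|now apply Rsum_mono].
  destruct k; rewrite ?Rsum_S, ?Rsum_0; [lra|].
  assert (Rsum (fun _ => 0%R) k <= Rsum a k)%R by (apply Rsum_le; intros; apply Ha).
  assert (Rsum (fun _ => 0%R) k = 0%R :> R).
  { clear. induction k; rewrite ?Rsum_S, ?Rsum_0; lra. }
  lra.
Qed.

Lemma Cmod_Csum_le (a : nat -> C) n :
  (Cmod (Csum a n) <= Rsum (fun k => Cmod (a k)) n)%R.
Proof.
  induction n as [|n IH]; rewrite ?Csum_S, ?Rsum_S, ?Csum_0, ?Rsum_0; [lra|].
  eapply Rle_trans; [apply Cmod_triangle|]. lra.
Qed.

Lemma Cseries_Csum (a : nat -> nat -> C) (l : nat -> C) K :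
  (forall k, Cseries (fun j => a j k) (l k)) ->
  Cseries (fun j => Csum (a j) K) (Csum l K).
Proof.
  intros H. induction K as [|K IH].
  - rewrite Csum_0. apply Cseries_ext with (2 := H 0%nat).
    intros; now rewrite Csum_0.
  - rewrite Csum_S. apply Cseries_ext with (2 := Cseries_plus _ _ _ _ IH (H (S K))).
    intros; now rewrite Csum_S.
Qed.

Lemma Cseries_norm_le (a : nat -> C) (l : C) (B : R) :
  Cseries a l -> (forall n, (Cmod (Csum a n) <= B)%R) -> (Cmod l <= B)%R.
Proof.
  intros H HB. apply Rnot_lt_le. intros Hlt.
  destruct (proj1 (Cseries_eps a l) H (Cmod l - B)%R ltac:(lra)) as [N HN].
  specialize (HN N (le_n N)). specialize (HB N).
  assert (Cmod l <= Cmod (Csum a N) + Cmod (Csum a N - l))%R; [|lra].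
  replace l with (Csum a N + - (Csum a N - l)) at 1 by ring.
  eapply Rle_trans; [apply Cmod_triangle|]. rewrite Cmod_opp. lra.
Qed.

Lemma ex_Cseries_le (a : nat -> C) (b : nat -> R) :
  (forall n, (Cmod (a n) <= b n)%R) -> ex_series b -> exists l : C, Cseries a l.
Proof.
  intros H Hb.
  exact (@ex_series_le C_AbsRing C_CompleteNormedModule a b H Hb).
Qed.

Lemma ex_series_bounded (b : nat -> R) (M : R) :
  (forall k, (0 <= b k)%R) -> (forall n, (Rsum b n <= M)%R) -> ex_series b.
Proof.
  intros Hb HM.
  destruct (ex_finite_lim_seq_incr (sum_n b) M) as [l Hl].
  - intros n. apply Rsum_mono; [assumption|lia].
  - exact HM.
  - exists l. exact Hl.
Qed.

Lemma Rsum_le_Series (b : nat -> R) n :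
  (forall k, (0 <= b k)%R) -> ex_series b -> (Rsum b n <= Series b)%R.
Proof.
  intros Hb Hex. apply Series_correct in Hex.
  apply (is_lim_seq_incr_compare (sum_n b)); [exact Hex|].
  intros k. apply Rsum_mono; [assumption|lia].
Qed.

Lemma Series_le_bound (b : nat -> R) (M : R) :
  (forall k, (0 <= b k)%R) -> (forall n, (Rsum b n <= M)%R) -> (Series b <= M)%R.
Proof.
  intros Hb HM.
  pose proof (Series_correct _ (ex_series_bounded b M Hb HM)) as H.
  exact (is_lim_seq_le (sum_n b) (fun _ => M) (Series b) M HM H (is_lim_seq_const M)).
Qed.

Lemma Series_tail (b : nat -> R) (eps : R) :
  ex_series b -> (0 < eps)%R ->
  exists N, forall n, (N <= n)%nat -> (Rabs (Rsum b n - Rsum b N) < eps)%R.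
Proof.
  intros Hb He. apply Series_correct in Hb.
  change (is_lim_seq (sum_n b) (Series b)) in Hb.
  apply is_lim_seq_spec in Hb.
  destruct (Hb (mkposreal (eps/2) ltac:(lra))) as [N HN]. simpl in HN.
  exists N. intros n Hn.
  pose proof (HN n Hn) as H1. pose proof (HN N (le_n N)) as H2.
  change (sum_n b) with (Rsum b) in *.
  apply Rabs_def2 in H1. apply Rabs_def2 in H2. apply Rabs_def1; lra.
Qed.

(** Tannery's theorem: under a summable bound independent of [K], a termwise
    limit (here 0) passes through the sum.  Only finitely many terms exceed the
    tail of the bound, and those are small for large [K]. *)
Lemma Cseries_tannery (a : nat -> nat -> C) (b : nat -> R) (T : nat -> C) :
  (forall j K, (Cmod (a j K) <= b j)%R) -> ex_series b ->
  (forall j eps, (0 < eps)%R ->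
     exists N, forall K, (N <= K)%nat -> (Cmod (a j K) < eps)%R) ->
  (forall K, Cseries (fun j => a j K) (T K)) ->
  forall eps, (0 < eps)%R ->
    exists N, forall K, (N <= K)%nat -> (Cmod (T K) < eps)%R.
Proof.
  intros Hab Hb Hlim HT eps He.
  destruct (Series_tail b (eps/3) Hb ltac:(lra)) as [J HJ].
  assert (Hfin : exists N, forall K, (N <= K)%nat ->
      (Rsum (fun j => Cmod (a j K)) J < eps / 3)%R).
  { assert (Hgen : forall J e, (0 < e)%R -> exists N, forall K, (N <= K)%nat ->
      (Rsum (fun j => Cmod (a j K)) J < e)%R).
    { clear J HJ. induction J as [|J IH]; intros e Hepos.
      - destruct (Hlim 0%nat e Hepos) as [N HN]. exists N. intros K HK.
        rewrite Rsum_0. now apply HN.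
      - destruct (IH (e/2)%R ltac:(lra)) as [N1 H1].
        destruct (Hlim (S J) (e/2)%R ltac:(lra)) as [N2 H2].
        exists (max N1 N2). intros K HK. rewrite Rsum_S.
        specialize (H1 K ltac:(lia)). specialize (H2 K ltac:(lia)). lra. }
    apply Hgen; lra. }
  destruct Hfin as [N HN]. exists N. intros K HK.
  apply Rle_lt_trans with (2 * (eps/3))%R; [|lra].
  apply Cseries_norm_le with (1 := HT K). intros n.
  eapply Rle_trans; [apply Cmod_Csum_le|].
  assert (Hb0 : forall j, (0 <= b j)%R).
  { intros j. eapply Rle_trans; [apply Cmod_ge_0|apply (Hab j 0%nat)]. }
  destruct (Compare_dec.le_lt_dec n J) as [Hn|Hn].
  - eapply Rle_trans; [apply Rsum_mono with (n := J); [intros; apply Cmod_ge_0|lia]|].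
    specialize (HN K HK). lra.
  - assert (Hsplit : forall n, (J <= n)%nat ->
      (Rsum (fun j => Cmod (a j K)) n <=
       Rsum (fun j => Cmod (a j K)) J + (Rsum b n - Rsum b J))%R).
    { clear n Hn. intros n Hn. induction Hn as [|n Hn IH]; [lra|].
      rewrite !Rsum_S. specialize (Hab (S n) K). lra. }
    specialize (Hsplit n ltac:(lia)). specialize (HN K HK).
    specialize (HJ n ltac:(lia)). apply Rabs_def2 in HJ. lra.
Qed.

(** Fubini for a double series that is absolutely summable row by row: the
    partial column sums differ from the row sums by row tails, to which
    Tannery's theorem applies. *)
Lemma Cseries_exchange (a : nat -> nat -> C) (b : nat -> R) (S T : nat -> C) (L : C) :
  (forall j K, (Rsum (fun k => Cmod (a j k)) K <= b j)%R) -> ex_series b ->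
  (forall j, Cseries (a j) (S j)) ->
  (forall k, Cseries (fun j => a j k) (T k)) ->
  Cseries S L -> Cseries T L.
Proof.
  intros Hab Hb HS HT HL. apply Cseries_eps. intros eps He.
  assert (HSb : forall j, (Cmod (S j) <= b j)%R).
  { intros j. apply Cseries_norm_le with (1 := HS j). intros n.
    eapply Rle_trans; [apply Cmod_Csum_le|apply Hab]. }
  apply (Cseries_tannery (fun j K => Csum (a j) K - S j) (fun j => 2 * b j)%R
           (fun K => Csum T K - L)); [| | | |assumption].
  - intros j K. unfold Cminus. eapply Rle_trans; [apply Cmod_triangle|].
    rewrite Cmod_opp. specialize (HSb j).
    assert (Cmod (Csum (a j) K) <= b j)%R; [|lra].
    eapply Rle_trans; [apply Cmod_Csum_le|apply Hab].
  - apply (ex_series_scal_l (K := R_AbsRing) (V := R_NormedModule) 2%R b Hb).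
  - intros j. apply Cseries_eps. apply HS.
  - intros K. apply Cseries_minus; [|assumption]. now apply Cseries_Csum.
Qed.

(** * Power series with summable coefficients *)

(** The weighted l1 norm of the Taylor coefficients at [s0].  It replaces the
    supremum norm on a disc: it is submultiplicative, and a series that
    converges absolutely in it is again a power series, whose coefficients are
    summed directly.  Limits of analytic functions are thus handled without
    Cauchy's integral formula. *)
Definition Wnorm_le (s0 : C) (r M : R) (h : C -> C) : Prop :=
  exists c : nat -> C,
    (forall K, (Rsum (fun k => Cmod (c k) * r ^ k)%R K <= M)%R) /\
    forall s, (Cmod (s - s0) < r)%R -> Cseries (fun k => c k * (s - s0) ^ k) (h s).

Lemma Wnorm_term_ge_0 (c : nat -> C) (r : R) k : (0 <= r)%R -> (0 <= Cmod (c k) * r ^ k)%R.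
Proof. intros Hr. apply Rmult_le_pos; [apply Cmod_ge_0|now apply pow_le]. Qed.

Lemma Wnorm_ext s0 r M (h g : C -> C) :
  (forall s, (Cmod (s - s0) < r)%R -> h s = g s) ->
  Wnorm_le s0 r M h -> Wnorm_le s0 r M g.
Proof.
  intros H [c [Hc Hs]]. exists c. split; [assumption|].
  intros s Hr. rewrite <- H by assumption. now apply Hs.
Qed.

Lemma Wnorm_weaken s0 r r' M M' h :
  (0 <= r' <= r)%R -> (M <= M')%R -> Wnorm_le s0 r M h -> Wnorm_le s0 r' M' h.
Proof.
  intros Hr HM [c [Hc Hs]]. exists c. split.
  - intros K. eapply Rle_trans; [|exact HM]. eapply Rle_trans; [|apply (Hc K)].
    apply Rsum_le. intros k _. apply Rmult_le_compat_l; [apply Cmod_ge_0|].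
    now apply pow_incr.
  - intros s H. apply Hs. lra.
Qed.

Lemma Wnorm_ge_0 s0 r M h : Wnorm_le s0 r M h -> (0 <= M)%R.
Proof.
  intros [c [Hc _]]. eapply Rle_trans; [|apply (Hc 0%nat)].
  rewrite Rsum_0. simpl. rewrite Rmult_1_r. apply Cmod_ge_0.
Qed.

Lemma Wnorm_term_le (c : nat -> C) (w : C) (r : R) k :
  (Cmod w <= r)%R -> (Cmod (c k * w ^ k) <= Cmod (c k) * r ^ k)%R.
Proof.
  intros H. rewrite Cmod_mult, Cmod_pow.
  apply Rmult_le_compat_l; [apply Cmod_ge_0|].
  apply pow_incr. split; [apply Cmod_ge_0|assumption].
Qed.

Lemma Wnorm_bound s0 r M h s :
  Wnorm_le s0 r M h -> (Cmod (s - s0) < r)%R -> (Cmod (h s) <= M)%R.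
Proof.
  intros [c [Hc Hs]] Hr. apply Cseries_norm_le with (1 := Hs s Hr). intros n.
  eapply Rle_trans; [apply Cmod_Csum_le|]. eapply Rle_trans; [|apply (Hc n)].
  apply Rsum_le. intros k _. apply Wnorm_term_le. lra.
Qed.

Lemma Cseries_single (a : nat -> C) : (forall k, a (S k) = 0) -> Cseries a (a 0%nat).
Proof.
  intros H. apply Cseries_eps. intros eps He. exists 0%nat. intros n _.
  assert (E : Csum a n = a 0%nat :> C).
  { induction n as [|n IH]; [apply Csum_0|]. rewrite Csum_S, IH, H. ring. }
  rewrite E. replace (a 0%nat - a 0%nat) with (RtoC 0) by ring. rewrite Cmod_0. lra.
Qed.

Lemma Wnorm_const s0 r (a : C) : (0 <= r)%R -> Wnorm_le s0 r (Cmod a) (fun _ => a).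
Proof.
  intros Hr. exists (fun k => match k with O => a | _ => 0 end). split.
  - intros K. apply Req_le. induction K as [|K IH].
    + rewrite Rsum_0. simpl. ring.
    + rewrite Rsum_S, IH, Cmod_0. ring.
  - intros s _. evar_last.
    + apply Cseries_single. intros k. ring.
    + simpl. ring.
Qed.

Lemma Wnorm_scal s0 r M (a : C) h :
  Wnorm_le s0 r M h -> Wnorm_le s0 r (Cmod a * M)%R (fun s => a * h s).
Proof.
  intros [c [Hc Hs]]. exists (fun k => a * c k). split.
  - intros K. apply Rle_trans with (Cmod a * Rsum (fun k => Cmod (c k) * r ^ k) K)%R.
    + apply Req_le. induction K as [|K IH]; rewrite ?Rsum_S, ?Rsum_0, ?IH, Cmod_mult; ring.
    + apply Rmult_le_compat_l; [apply Cmod_ge_0|apply Hc].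
  - intros s Hr. apply Cseries_ext with (2 := Cseries_scal a _ _ (Hs s Hr)).
    intros; ring.
Qed.

Lemma Wnorm_plus s0 r M M' h g : (0 <= r)%R ->
  Wnorm_le s0 r M h -> Wnorm_le s0 r M' g ->
  Wnorm_le s0 r (M + M')%R (fun s => h s + g s).
Proof.
  intros Hr0 [c [Hc Hs]] [d [Hd Ht]]. exists (fun k => c k + d k). split.
  - intros K. specialize (Hc K). specialize (Hd K).
    eapply Rle_trans; [|apply Rplus_le_compat; eassumption].
    clear Hc Hd. induction K as [|K IH]; rewrite ?Rsum_S, ?Rsum_0.
    + simpl. pose proof (Cmod_triangle (c 0%nat) (d 0%nat)). lra.
    + pose proof (Cmod_triangle (c (S K)) (d (S K))).
      pose proof (pow_le r (S K) Hr0). nra.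
  - intros s Hr.
    apply Cseries_ext with (2 := Cseries_plus _ _ _ _ (Hs s Hr) (Ht s Hr)).
    intros; ring.
Qed.

Lemma Cseries_cons (a : nat -> C) (l : C) :
  a 0%nat = 0 -> Cseries (fun k => a (S k)) l -> Cseries a l.
Proof.
  intros H0 H. apply (@is_series_decr_1 C_AbsRing C_NormedModule).
  rewrite H0. change (Cseries (fun k => a (S k)) (l + - 0)).
  now replace (l + - 0) with l by ring.
Qed.

(** Multiplying by [s - s0] moves each coefficient one place up. *)
Lemma Wnorm_shift s0 r M h : (0 <= r)%R ->
  Wnorm_le s0 r M h -> Wnorm_le s0 r (r * M)%R (fun s => (s - s0) * h s).
Proof.
  intros Hr0 [c [Hc Hs]]. exists (fun k => match k with O => RtoC 0 | S k => c k end). split.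
  - intros K. destruct K as [|K].
    + rewrite Rsum_0, Cmod_0, Rmult_0_l. apply Rmult_le_pos; [assumption|].
      apply (Wnorm_ge_0 s0 r M h). now exists c.
    + apply Rle_trans with (r * Rsum (fun k => Cmod (c k) * r ^ k) K)%R.
      * apply Req_le. clear Hc. induction K as [|K IH].
        -- rewrite Rsum_S, !Rsum_0, Cmod_0. simpl. ring.
        -- rewrite Rsum_S, IH, Rsum_S. simpl. ring.
      * apply Rmult_le_compat_l; [assumption|apply Hc].
  - intros s Hr. apply Cseries_cons; [ring|].
    apply Cseries_ext with (2 := Cseries_scal (s - s0) _ _ (Hs s Hr)).
    intros; rewrite Cpow_S; ring.
Qed.

Lemma Rsum_Series_exchange (a : nat -> nat -> R) K :
  (forall k, ex_series (a k)) ->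
  ex_series (fun j => Rsum (fun k => a k j) K) /\
  Rsum (fun k => Series (a k)) K = Series (fun j => Rsum (fun k => a k j) K) :> R.
Proof.
  intros H. induction K as [|K [IH1 IH2]].
  - split.
    + apply ex_series_ext with (2 := H 0%nat). intros. now rewrite Rsum_0.
    + rewrite Rsum_0. apply Series_ext. intros. now rewrite Rsum_0.
  - pose proof (ex_series_plus (K := R_AbsRing) (V := R_NormedModule) _ _ IH1 (H (S K))) as E.
    split.
    + apply ex_series_ext with (2 := E). intros. now rewrite Rsum_S.
    + rewrite Rsum_S, IH2, <- Series_plus by auto.
      apply Series_ext. intros. now rewrite Rsum_S.
Qed.

(** Completeness of the norm.  The k-th coefficient of the sum is the sum of the
    k-th coefficients, and evaluating at a point is an exchange of summations. *)
Lemma Wnorm_series s0 r (M : nat -> R) (h : nat -> C -> C) (H : C -> C) :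
  (0 < r)%R -> (forall j, Wnorm_le s0 r (M j) (h j)) -> ex_series M ->
  (forall s, (Cmod (s - s0) < r)%R -> Cseries (fun j => h j s) (H s)) ->
  Wnorm_le s0 r (Series M) H.
Proof.
  intros Hr Hh HM HH.
  destruct (choose_function _ Hh) as [c Hc].
  assert (HM0 : forall j, (0 <= M j)%R) by (intros j; apply (Wnorm_ge_0 _ _ _ _ (Hh j))).
  assert (Hterm : forall j k, (Cmod (c j k) * r ^ k <= M j)%R).
  { intros j k. eapply Rle_trans; [|apply (proj1 (Hc j) k)].
    apply (Rsum_term_le (fun k => Cmod (c j k) * r ^ k)%R k k); [|lia].
    intros; apply Wnorm_term_ge_0; lra. }
  assert (Hex : forall k, ex_series (fun j => Cmod (c j k) * r ^ k)%R).
  { intros k. apply (@ex_series_le R_AbsRing R_CompleteNormedModule) with (b := M); [|assumption].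
    intros j. change (Rabs (Cmod (c j k) * r ^ k) <= M j)%R.
    rewrite Rabs_pos_eq; [apply Hterm|apply Wnorm_term_ge_0; lra]. }
  assert (HT : forall k, exists t : C, Cseries (fun j => c j k) t).
  { intros k. apply ex_Cseries_le with (b := fun j => (Cmod (c j k) * r ^ k * / r ^ k)%R).
    - intros j. apply Req_le. field. apply pow_nonzero. lra.
    - apply (ex_series_scal_r (/ r ^ k)%R). apply Hex. }
  destruct (choose_function _ HT) as [T HTs].
  assert (Hrow : forall j K, (Rsum (fun k => Cmod (c j k) * r ^ k)%R K <= M j)%R).
  { intros j. apply (Hc j). }
  exists T. split.
  - intros K.
    apply Rle_trans with (Rsum (fun k => Series (fun j => Cmod (c j k) * r ^ k)%R) K).
    + apply Rsum_le. intros k _.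
      assert (Hn : (forall n, Cmod (Csum (fun j => c j k) n) <=
                  Series (fun j => Cmod (c j k) * r ^ k) * / r ^ k)%R).
      { intros n. rewrite <- Series_scal_r.
        eapply Rle_trans; [apply Cmod_Csum_le|].
        eapply Rle_trans; [|apply (Rsum_le_Series _ n)].
        - apply Rsum_le. intros j _. apply Req_le. field. apply pow_nonzero. lra.
        - intros j. apply Rmult_le_pos; [apply Wnorm_term_ge_0; lra|].
          apply Rlt_le, Rinv_0_lt_compat, pow_lt, Hr.
        - apply (ex_series_scal_r (/ r ^ k)%R). apply Hex. }
      pose proof (Cseries_norm_le _ _ _ (HTs k) Hn) as Hb.
      apply Rmult_le_reg_r with (/ r ^ k)%R; [apply Rinv_0_lt_compat, pow_lt, Hr|].
      eapply Rle_trans; [|exact Hb]. apply Req_le. field. apply pow_nonzero. lra.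
    + destruct (Rsum_Series_exchange (fun k j => Cmod (c j k) * r ^ k)%R K Hex) as [_ ->].
      apply Series_le; [|assumption]. intros j. split; [|apply Hrow].
      apply Rle_trans with (2 := Rsum_mono _ 0 K
        (fun k => Wnorm_term_ge_0 (c j) r k (Rlt_le _ _ Hr)) (Nat.le_0_l _)).
      rewrite Rsum_0. apply Wnorm_term_ge_0; lra.
  - intros s Hs.
    apply (Cseries_exchange (fun j k => c j k * (s - s0) ^ k) M (fun j => h j s)).
    + intros j K. eapply Rle_trans; [|apply (Hrow j K)].
      apply Rsum_le. intros k _. apply Wnorm_term_le. lra.
    + assumption.
    + intros j. now apply (Hc j).
    + intros k. rewrite Cmult_comm.
      apply Cseries_ext with (2 := Cseries_scal ((s - s0) ^ k) _ _ (HTs k)).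
      intros; ring.
    + now apply HH.
Qed.

(** A product is the sum of the functions [c k * (s - s0) ^ k * g s], which have
    norm at most [Cmod (c k) * r ^ k * M'], so completeness spares the Cauchy
    product. *)
Lemma Wnorm_mult s0 r M M' h g : (0 < r)%R ->
  Wnorm_le s0 r M h -> Wnorm_le s0 r M' g ->
  Wnorm_le s0 r (M * M')%R (fun s => h s * g s).
Proof.
  intros Hr [c [Hc Hs]] Hg.
  pose proof (Wnorm_ge_0 _ _ _ _ Hg) as HM'.
  assert (Hc0 : forall k, (0 <= Cmod (c k) * r ^ k)%R) by (intros; apply Wnorm_term_ge_0; lra).
  apply Wnorm_weaken with (r := r) (M := Series (fun k => Cmod (c k) * r ^ k * M')%R).
  - lra.
  - rewrite Series_scal_r. apply Rmult_le_compat_r; [assumption|].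
    now apply Series_le_bound.
  - apply (Wnorm_series s0 r _ (fun k s => c k * ((s - s0) ^ k * g s))); [assumption| | |].
    + intros k. rewrite Rmult_assoc. apply Wnorm_scal.
      induction k as [|k IH].
      * simpl. rewrite Rmult_1_l. apply Wnorm_ext with (2 := Hg). intros; ring.
      * simpl. rewrite Rmult_assoc.
        apply Wnorm_ext with (2 := Wnorm_shift s0 r _ _ (Rlt_le _ _ Hr) IH).
        intros; ring.
    + apply (ex_series_scal_r M'). now apply ex_series_bounded with M.
    + intros s Hsr. rewrite Cmult_comm.
      apply Cseries_ext with (2 := Cseries_scal (g s) _ _ (Hs s Hsr)). intros; ring.
Qed.

Lemma Wnorm_pow s0 r M h n : (0 < r)%R ->
  Wnorm_le s0 r M h -> Wnorm_le s0 r (M ^ n)%R (fun s => h s ^ n).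
Proof.
  intros Hr Hh. induction n as [|n IH]; simpl.
  - pose proof (Wnorm_const s0 r 1 (Rlt_le _ _ Hr)) as H1. now rewrite Cmod_1 in H1.
  - now apply Wnorm_mult.
Qed.

Lemma Wnorm_id s0 r : (0 < r)%R -> Wnorm_le s0 r (Cmod s0 + r)%R (fun s => s).
Proof.
  intros Hr. apply Wnorm_ext with (h := fun s => s0 + (s - s0) * 1).
  - intros; ring.
  - apply Wnorm_plus; [lra|apply Wnorm_const; lra|].
    replace r with (r * Cmod 1)%R at 2 by (rewrite Cmod_1; ring).
    apply Wnorm_shift; [lra|]. apply Wnorm_const. lra.
Qed.

(** * The exponential series *)

Lemma exp_mono (x y : R) : (x <= y)%R -> (exp x <= exp y)%R.
Proof. intros [H | ->]; [apply Rlt_le, exp_increasing, H|lra]. Qed.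

Lemma Cexp_0 : Cexp 0 = 1.
Proof. unfold Cexp; simpl. rewrite exp_0, cos_0, sin_0. apply injective_projections; simpl; ring. Qed.

Lemma Cexp_plus (a b : C) : Cexp (a + b) = Cexp a * Cexp b.
Proof.
  destruct a as [a1 a2], b as [b1 b2]. unfold Cexp. simpl.
  rewrite exp_plus, cos_plus, sin_plus. apply injective_projections; simpl; ring.
Qed.

Lemma Cmod_Cexp (z : C) : Cmod (Cexp z) = exp (Re z).
Proof.
  destruct z as [x y]. unfold Cmod, Cexp; simpl.
  replace (_ + _)%R with ((exp x)²).
  - apply sqrt_Rsqr. apply Rlt_le, exp_pos.
  - pose proof (sin2_cos2 y). unfold Rsqr in *. nra.
Qed.

Lemma Cexp_neq_0 (z : C) : Cexp z <> 0.
Proof. apply Cmod_gt_0. rewrite Cmod_Cexp. apply exp_pos. Qed.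

Lemma Cexp_mult_INR (n : nat) (z : C) : Cexp (INR n * z) = Cexp z ^ n.
Proof.
  induction n as [|n IH].
  - simpl. now rewrite Cmult_0_l, Cexp_0.
  - rewrite S_INR, Cpow_S, <- IH, <- Cexp_plus. f_equal. rewrite RtoC_plus. ring.
Qed.

(** On the ray through [z], differentiating in [t] multiplies by [z].  The
    factor [u] lets the same computation serve the real part ([u = 1]) and the
    imaginary part ([u = - Ci]). *)
Lemma exp_ray_derive (u z : C) (n : nat) (t : R) :
  is_derive_n (fun t : R => Re (u * Cexp (t * z))) n t (Re (u * z ^ n * Cexp (t * z))).
Proof.
  revert t. induction n as [|n IH]; intros t.
  - simpl (z ^ 0). now rewrite Cmult_1_r.
  - apply (is_derive_ext (fun t : R => Re (u * z ^ n * Cexp (t * z)))).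
    + intros s. symmetry. apply is_derive_n_unique, IH.
    + rewrite Cpow_S.
      replace (u * (z * z ^ n)) with ((u * z ^ n) * z) by ring.
      destruct (u * z ^ n) as [a b]. destruct z as [x y]. clear.
      unfold Cexp. simpl. auto_derive; [exact I|].
      replace (t * x - 0 * y)%R with (t * x)%R by ring.
      replace (t * y + 0 * x)%R with (t * y)%R by ring.
      replace (t * x + - (0 * y))%R with (t * x)%R by ring. ring.
Qed.

Lemma Re_Csum (a : nat -> C) n : Re (Csum a n) = sum_f_R0 (fun k => Re (a k)) n.
Proof.
  induction n as [|n IH]; [now rewrite Csum_0|].
  rewrite Csum_S. simpl. now rewrite <- IH.
Qed.

Definition exp_term (z : C) (k : nat) : C := z ^ k * (/ INR (fact k))%R.

(** Lagrange's remainder for [t |-> Re (u * Cexp (t * z))] between 0 and 1. *)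
Lemma exp_taylor_Re (u z : C) (n : nat) :
  (Rabs (Re (u * (Cexp z - Csum (exp_term z) n))) <=
   Cmod u * (Cmod z ^ S n / INR (fact (S n)) * exp (Cmod z)))%R.
Proof.
  destruct (Taylor_Lagrange (fun t : R => Re (u * Cexp (t * z))) n 0 1)
    as [t [Ht Heq]]; [lra| |].
  { intros t _ k _. destruct k; [exact I|].
    eexists. apply (exp_ray_derive u z (S k) t). }
  rewrite (is_derive_n_unique _ _ _ _ (exp_ray_derive u z (S n) t)) in Heq.
  rewrite Cmult_1_l in Heq.
  assert (E : (Re (u * (Cexp z - Csum (exp_term z) n)) =
    (1 - 0) ^ S n / INR (fact (S n)) * Re (u * z ^ S n * Cexp (t * z))%C)%R).
  { replace (u * (Cexp z - Csum (exp_term z) n))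
      with (u * Cexp z - u * Csum (exp_term z) n) by ring.
    rewrite <- Csum_scal. unfold Cminus.
    change (Re (u * Cexp z)%C + - Re (Csum (fun k => u * exp_term z k)%C n) =
      (1 - 0) ^ S n / INR (fact (S n)) * Re (u * z ^ S n * Cexp (t * z))%C)%R.
    rewrite Heq, Re_Csum.
    rewrite (sum_eq (fun m => (1 - 0) ^ m / INR (fact m) *
        Derive_n (fun t : R => Re (u * Cexp (t * z))%C) m 0)%R
       (fun k => Re (u * exp_term z k)%C)); [ring|].
    intros k _. rewrite (is_derive_n_unique _ _ _ _ (exp_ray_derive u z k 0)).
    rewrite Cmult_0_l, Cexp_0, Rminus_0_r, pow1. unfold exp_term.
    destruct (z ^ k) as [a b]. simpl. unfold Rdiv. ring. }
  rewrite E, Rminus_0_r, pow1, Rabs_mult.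
  assert (Hf : (0 < INR (fact (S n)))%R) by apply INR_fact_lt_0.
  rewrite (Rabs_pos_eq (1 / _)) by (apply Rlt_le, Rdiv_lt_0_compat; lra).
  replace (Cmod u * (Cmod z ^ S n / INR (fact (S n)) * exp (Cmod z)))%R
    with (1 / INR (fact (S n)) * (Cmod u * Cmod z ^ S n * exp (Cmod z)))%R by (field; lra).
  apply Rmult_le_compat_l; [apply Rlt_le, Rdiv_lt_0_compat; lra|].
  eapply Rle_trans; [apply re_le_Cmod|].
  rewrite !Cmod_mult, Cmod_pow, Cmod_Cexp.
  apply Rmult_le_compat_l.
  { apply Rmult_le_pos; [apply Cmod_ge_0|apply pow_le, Cmod_ge_0]. }
  assert (Hle : (Re (t * z) <= Cmod z)%R).
  { eapply Rle_trans; [apply Rle_abs|]. eapply Rle_trans; [apply re_le_Cmod|].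
    rewrite Cmod_mult, Cmod_R, Rabs_pos_eq by lra.
    pose proof (Cmod_ge_0 z). nra. }
  now apply exp_mono.
Qed.

Lemma Cmod_le_Re_Im (z : C) : (Cmod z <= Rabs (Re z) + Rabs (Im z))%R.
Proof.
  replace z with (RtoC (Re z) + Ci * RtoC (Im z)) at 1.
  - eapply Rle_trans; [apply Cmod_triangle|].
    rewrite Cmod_mult, Cmod_Ci, !Cmod_R. lra.
  - destruct z. apply injective_projections; simpl; ring.
Qed.

Lemma Cexp_series (z : C) : Cseries (exp_term z) (Cexp z).
Proof.
  apply Cseries_eps. intros eps He.
  pose proof (exp_pos (Cmod z)) as HE.
  destruct (cv_speed_pow_fact (Cmod z) (eps / (2 * exp (Cmod z)))%R) as [N HN].
  { apply Rlt_gt, Rdiv_lt_0_compat; lra. }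
  exists N. intros n Hn. specialize (HN (S n) ltac:(lia)).
  unfold Rdist in HN. rewrite Rminus_0_r in HN.
  pose proof (exp_taylor_Re 1 z n) as H1.
  pose proof (exp_taylor_Re (- Ci) z n) as H2.
  rewrite Cmod_1 in H1. rewrite Cmod_opp, Cmod_Ci in H2.
  replace (Csum (exp_term z) n - Cexp z) with (- (Cexp z - Csum (exp_term z) n)) by ring.
  rewrite Cmod_opp. eapply Rle_lt_trans; [apply Cmod_le_Re_Im|].
  destruct (Cexp z - Csum (exp_term z) n) as [a b].
  replace (Re (1 * (a, b))) with a in H1 by (simpl; ring).
  replace (Re (- Ci * (a, b))) with b in H2 by (simpl; ring).
  simpl (Re (a, b)). simpl (Im (a, b)).
  apply (Rmult_lt_compat_r (2 * exp (Cmod z))) in HN; [|lra].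
  replace (eps / (2 * exp (Cmod z)) * (2 * exp (Cmod z)))%R with eps in HN by (field; lra).
  rewrite Rabs_pos_eq in HN; [lra|].
  apply Rdiv_le_0_compat; [apply pow_le, Cmod_ge_0|apply INR_fact_lt_0].
Qed.

Lemma exp_series_R (M : R) : is_series (fun k => M ^ k * / INR (fact k))%R (exp M).
Proof.
  pose proof (is_exp_Reals M) as H. unfold is_pseries in H.
  apply is_series_ext with (2 := H). intros n.
  rewrite pow_n_pow. reflexivity.
Qed.

Lemma Wnorm_exp s0 r M h : (0 < r)%R ->
  Wnorm_le s0 r M h -> Wnorm_le s0 r (exp M) (fun s => Cexp (h s)).
Proof.
  intros Hr Hh. rewrite <- (is_series_unique _ _ (exp_series_R M)).
  apply (Wnorm_series s0 r _ (fun k s => exp_term (h s) k)); [assumption| | |].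
  - intros k. pose proof (Wnorm_scal _ _ _ (/ INR (fact k))%R _ (Wnorm_pow _ _ _ _ k Hr Hh)) as H.
    rewrite Cmod_R, Rabs_pos_eq in H by (apply Rlt_le, Rinv_0_lt_compat, INR_fact_lt_0).
    rewrite Rmult_comm in H. apply Wnorm_ext with (2 := H). intros. apply Cmult_comm.
  - eexists. apply exp_series_R.
  - intros. apply Cexp_series.
Qed.

Lemma Wnorm_exp_tail s0 r M h N : (0 < r)%R ->
  Wnorm_le s0 r M h ->
  Wnorm_le s0 r (M ^ S N * exp M)%R
    (fun s => Cexp (h s) - Csum (exp_term (h s)) N).
Proof.
  intros Hr Hh. rewrite <- (is_series_unique _ _ (exp_series_R M)).
  rewrite <- Series_scal_l. pose proof (Wnorm_ge_0 _ _ _ _ Hh) as HM.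
  apply (Wnorm_series s0 r _ (fun k s => exp_term (h s) (S N + k))); [assumption| | |].
  - intros k.
    pose proof (Wnorm_scal _ _ _ (/ INR (fact (S N + k)))%R _
      (Wnorm_pow _ _ _ _ (S N + k) Hr Hh)) as H.
    rewrite Cmod_R, Rabs_pos_eq in H by (apply Rlt_le, Rinv_0_lt_compat, INR_fact_lt_0).
    apply Wnorm_ext with (h := fun s => (/ INR (fact (S N + k)))%R * h s ^ (S N + k)).
    { intros. apply Cmult_comm. }
    apply Wnorm_weaken with (3 := H); [lra|].
    rewrite pow_add.
    replace (M ^ S N * (M ^ k * / INR (fact k)))%R
      with (/ INR (fact k) * (M ^ S N * M ^ k))%R by ring.
    apply Rmult_le_compat_r; [apply Rmult_le_pos; now apply pow_le|].
    apply Rinv_le_contravar; [apply INR_fact_lt_0|].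
    apply le_INR, fact_le. lia.
  - apply (ex_series_scal_l (K := R_AbsRing) (V := R_NormedModule) (M ^ S N)%R).
    eexists. apply exp_series_R.
  - intros s _.
    apply (@is_series_incr_n C_AbsRing C_NormedModule (exp_term (h s)) (S N)); [lia|].
    simpl. change (Cseries (exp_term (h s))
      (Cexp (h s) - Csum (exp_term (h s)) N + Csum (exp_term (h s)) N)).
    replace (Cexp (h s) - Csum (exp_term (h s)) N + Csum (exp_term (h s)) N)
      with (Cexp (h s)) by ring.
    apply Cexp_series.
Qed.

(** * Logarithms of the numbers v + j *)

Lemma Re_ratio_bounds (w : C) : w <> 0 -> (-1 <= Re w / Cmod w <= 1)%R.
Proof.
  intros Hw. apply Cmod_gt_0 in Hw. pose proof (re_le_Cmod w) as H.
  apply Rabs_le_between in H.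
  split; [apply Rle_div_r | apply Rle_div_l]; lra.
Qed.

Lemma sin_arg_ratio (w : C) : w <> 0 ->
  sqrt (1 - (Re w / Cmod w)²) = (Rabs (Im w) / Cmod w)%R.
Proof.
  intros Hw. apply Cmod_gt_0 in Hw.
  replace (1 - (Re w / Cmod w)²)%R with ((Im w / Cmod w)²)%R.
  - rewrite sqrt_Rsqr_abs. unfold Rdiv. rewrite Rabs_mult, (Rabs_pos_eq (/ _)); [reflexivity|].
    apply Rlt_le, Rinv_0_lt_compat, Hw.
  - pose proof (Cmod2_alt w) as E. unfold Rsqr. field_simplify; [|lra|lra].
    rewrite E. field. rewrite <- E. apply pow_nonzero. lra.
Qed.

Lemma Cexp_Clog (w : C) : w <> 0 -> Cexp (Clog w) = w.
Proof.
  intros Hw. pose proof (Re_ratio_bounds w Hw) as Hr. pose proof (sin_arg_ratio w Hw) as Hs.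
  apply Cmod_gt_0 in Hw. unfold Cexp, Clog, Carg. simpl Re. simpl Im.
  rewrite exp_ln by assumption.
  destruct (Rle_dec 0 (Im w)) as [H|H].
  - rewrite cos_acos, sin_acos, Hs, Rabs_pos_eq by assumption.
    generalize dependent (Cmod w). intros c ? ? ?. destruct w as [x y].
    apply injective_projections; simpl; field; lra.
  - apply Rnot_le_lt in H. rewrite cos_neg, sin_neg, cos_acos, sin_acos, Hs, Rabs_left by (assumption || lra).
    generalize dependent (Cmod w). intros c ? ? ?. destruct w as [x y].
    apply injective_projections; simpl; field; lra.
Qed.

Lemma Carg_bound (w : C) : (Rabs (Carg w) <= PI)%R.
Proof.
  unfold Carg. pose proof (acos_bound (Re w / Cmod w)).
  destruct Rle_dec; apply Rabs_le; lra.
Qed.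

Lemma atan_le_id (t : R) : (0 <= t)%R -> (atan t <= t)%R.
Proof.
  intros [Ht | <-]; [|rewrite atan_0; lra].
  destruct (MVT_gen atan 0 t (fun x => / (1 + x ^ 2))%R) as [c [_ Hc]].
  - intros x _. auto_derive; [exact I|]. unfold Rsqr. field. nra.
  - intros x _. apply continuity_pt_filterlim.
    apply (ex_derive_continuous atan). auto_derive. exact I.
  - rewrite atan_0, !Rminus_0_r in Hc. rewrite Hc.
    assert (/ (1 + c ^ 2) <= 1)%R; [|nra].
    rewrite <- Rinv_1. apply Rinv_le_contravar; nra.
Qed.

(** In the right half-plane the argument is an arctangent, hence at most the
    tangent.  For [v + j] with large [j] this makes it of order [1 / j]. *)
Lemma Carg_small (w : C) : (0 < Re w)%R -> (Rabs (Carg w) <= Rabs (Im w) / Re w)%R.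
Proof.
  intros Hx. assert (Hw : w <> 0) by (intros ->; simpl in Hx; lra).
  pose proof (sin_arg_ratio w Hw) as Hs. apply Cmod_gt_0 in Hw.
  assert (Ha : Rabs (Carg w) = acos (Re w / Cmod w)).
  { unfold Carg. pose proof (acos_bound (Re w / Cmod w)).
    destruct Rle_dec; [|rewrite Rabs_Ropp]; apply Rabs_pos_eq; lra. }
  rewrite Ha, acos_atan, Hs by (apply Rdiv_lt_0_compat; assumption).
  replace (Rabs (Im w) / Cmod w / (Re w / Cmod w))%R with (Rabs (Im w) / Re w)%R by (field; lra).
  apply atan_le_id, Rdiv_le_0_compat; [apply Rabs_pos|assumption].
Qed.

Lemma Clog_scal (x : R) (w : C) : (0 < x)%R -> w <> 0 ->
  Clog (x * w) = ln x + Clog w.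
Proof.
  intros Hx Hw. apply Cmod_gt_0 in Hw.
  assert (Hm : Cmod (x * w) = (x * Cmod w)%R).
  { rewrite Cmod_mult, Cmod_R, Rabs_pos_eq; lra. }
  assert (Hre : Re (x * w) = (x * Re w)%R) by (destruct w; simpl; ring).
  assert (Him : Im (x * w) = (x * Im w)%R) by (destruct w; simpl; ring).
  unfold Clog. apply injective_projections; simpl fst; simpl snd.
  - rewrite Hm. now apply ln_mult.
  - unfold Carg. rewrite Hm, Hre, Him.
    replace (x * Re w / (x * Cmod w))%R with (Re w / Cmod w)%R by (field; lra).
    destruct (Rle_dec 0 (x * Im w)) as [H|H], (Rle_dec 0 (Im w)) as [H'|H']; try ring;
    exfalso; nra.
Qed.

(** The scale in which decay in the summation index is measured; the shift by
    one keeps it meaningful at [j = 0]. *)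
Definition recip (j : nat) : R := (/ (INR j + 1))%R.

Lemma recip_bounds j : (0 < recip j <= 1)%R.
Proof.
  unfold recip. pose proof (pos_INR j). split; [apply Rinv_0_lt_compat; lra|].
  rewrite <- Rinv_1 at 2. apply Rinv_le_contravar; lra.
Qed.

(** Finitely many terms never affect boundedness, so that estimates for
    [v + INR j] need only be proved where its real part is large. *)
Lemma eventually_le_bounded (u : nat -> R) (J : nat) (B : R) :
  (forall j, (J <= j)%nat -> (u j <= B)%R) -> exists B', forall j, (u j <= B')%R.
Proof.
  revert B. induction J as [|J IH]; intros B H.
  - exists B. intros. apply H. lia.
  - apply (IH (Rmax B (u J))). intros j Hj. destruct (Nat.eq_dec j J) as [->|Hne].
    + apply Rmax_r.
    + eapply Rle_trans; [apply H; lia|apply Rmax_l].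
Qed.

Definition nonpole (v : C) : Prop := forall j : nat, v <> - INR j.

Lemma nonpole_neq_0 (v : C) j : nonpole v -> v + INR j <> 0.
Proof.
  intros Hv H. apply (Hv j). replace v with (v + INR j - INR j) by ring. rewrite H. ring.
Qed.

Lemma far_shift (v : C) (j : nat) : (2 * Cmod v + 1 <= INR j)%R ->
  (/ 2 * (INR j + 1) <= Re (v + INR j))%R.
Proof.
  intros H. pose proof (re_le_Cmod v) as Hr.
  apply Rabs_le_between in Hr. destruct v as [x y]. simpl in *. lra.
Qed.

Lemma far_index (B : R) : exists J, forall j, (J <= j)%nat -> (B <= INR j)%R.
Proof.
  destruct (INR_unbounded B) as [J HJ]. exists J. intros j Hj.
  apply le_INR in Hj. lra.
Qed.

Lemma inv_shift_bound (v : C) : nonpole v ->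
  exists B, forall j, (/ Cmod (v + INR j) <= B * recip j)%R.
Proof.
  intros Hv. destruct (far_index (2 * Cmod v + 1)) as [J HJ].
  destruct (eventually_le_bounded (fun j => (INR j + 1) / Cmod (v + INR j))%R J 2) as [B HB].
  - intros j Hj. specialize (HJ j Hj). pose proof (far_shift v j HJ) as Hf.
    pose proof (re_le_Cmod (v + INR j)) as Hr. apply Rabs_le_between in Hr.
    pose proof (pos_INR j). apply Rle_div_l; lra.
  - exists B. intros j. specialize (HB j). unfold recip.
    pose proof (nonpole_neq_0 v j Hv) as Hn. apply Cmod_gt_0 in Hn. pose proof (pos_INR j).
    apply Rle_div_r; [lra|]. unfold Rdiv in HB. rewrite Rmult_comm. exact HB.
Qed.

Lemma log_growth (v : C) : nonpole v ->
  exists B, forall j, (Rabs (ln (Cmod (v + INR j)) - ln (INR j + 1)) <= B)%R.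
Proof.
  intros Hv. destruct (inv_shift_bound v Hv) as [B HB].
  exists (Rabs (ln B) + Rabs (ln (Cmod v + 1)))%R. intros j.
  specialize (HB j). unfold recip in HB.
  pose proof (nonpole_neq_0 v j Hv) as Hn. apply Cmod_gt_0 in Hn. pose proof (pos_INR j) as Hj.
  assert (HBpos : (0 < B)%R).
  { pose proof (Rinv_0_lt_compat _ Hn). pose proof (Rinv_0_lt_compat (INR j + 1) ltac:(lra)).
    apply Rnot_le_lt. intros HBn. nra. }
  pose proof (Cmod_ge_0 v) as Hv0.
  assert (H1 : (INR j + 1 <= B * Cmod (v + INR j))%R).
  { apply (Rmult_le_compat_r (Cmod (v + INR j) * (INR j + 1))) in HB; [|nra].
    field_simplify in HB; lra. }
  assert (H2 : (Cmod (v + INR j) <= (Cmod v + 1) * (INR j + 1))%R).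
  { eapply Rle_trans; [apply Cmod_triangle|]. rewrite Cmod_R, Rabs_pos_eq by assumption. nra. }
  apply ln_le in H1; [|lra]. apply ln_le in H2; [|lra].
  rewrite ln_mult in H1, H2 by lra.
  pose proof (Rle_abs (ln B)). pose proof (Rle_abs (ln (Cmod v + 1))).
  pose proof (Rabs_pos (ln B)). pose proof (Rabs_pos (ln (Cmod v + 1))).
  apply Rabs_le. lra.
Qed.

Definition shift_log (v : C) (j : nat) : C := Clog (v + INR j).

(** The difference of two principal logarithms, rather than the logarithm of
    [1 + / (v + INR j)]: its exponential is exact for all [j], whichever
    branches are met. *)
Definition log_step (v : C) (j : nat) : C := shift_log v (S j) - shift_log v j.

Lemma Cexp_shift_log (v : C) j : nonpole v -> Cexp (shift_log v j) = v + INR j.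
Proof. intros Hv. apply Cexp_Clog. now apply nonpole_neq_0. Qed.

Lemma Cexp_opp (z : C) : Cexp (- z) = / Cexp z.
Proof.
  pose proof (Cexp_neq_0 z) as Hz.
  transitivity (Cexp (- z) * Cexp z * / Cexp z); [now field|].
  rewrite <- Cexp_plus. replace (- z + z) with (RtoC 0) by ring. rewrite Cexp_0. ring.
Qed.

Lemma Cexp_log_step (v : C) j : nonpole v ->
  Cexp (log_step v j) = 1 + / (v + INR j).
Proof.
  intros Hv. unfold log_step, Cminus. rewrite Cexp_plus, Cexp_opp, !Cexp_shift_log by assumption.
  pose proof (nonpole_neq_0 v j Hv). rewrite S_INR, RtoC_plus. field. assumption.
Qed.

Lemma ln_diff_le (a b : R) : (0 < a)%R -> (0 < b)%R -> (a - b <= 1)%R ->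
  (ln a - ln b <= / b)%R.
Proof.
  intros Ha Hb H. rewrite <- ln_div by assumption.
  apply Rle_trans with (a / b - 1)%R.
  - pose proof (exp_ineq1_le (ln (a / b))) as E.
    rewrite exp_ln in E by now apply Rdiv_lt_0_compat. lra.
  - replace (/ b)%R with (1 * / b)%R by ring.
    replace (a / b - 1)%R with ((a - b) * / b)%R by (field; lra).
    apply Rmult_le_compat_r; [apply Rlt_le, Rinv_0_lt_compat; assumption|lra].
Qed.

Lemma recip_S_le j : (recip (S j) <= recip j)%R.
Proof.
  unfold recip. rewrite S_INR. pose proof (pos_INR j). apply Rinv_le_contravar; lra.
Qed.

(** For large [j] the moduli of consecutive [v + INR j] differ by at most 1, which
    controls the real part, and both arguments are small by themselves. *)
Lemma log_step_bound (v : C) : nonpole v ->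
  exists B, forall j, (Cmod (log_step v j) <= B * recip j)%R.
Proof.
  intros Hv. destruct (inv_shift_bound v Hv) as [B HB].
  assert (HB0 : (0 <= B)%R).
  { specialize (HB 0%nat). pose proof (recip_bounds 0).
    pose proof (nonpole_neq_0 v 0 Hv) as Hn. apply Cmod_gt_0 in Hn.
    apply Rinv_0_lt_compat in Hn. nra. }
  destruct (far_index (2 * Cmod v + 1)) as [J HJ].
  destruct (eventually_le_bounded (fun j => Cmod (log_step v j) * (INR j + 1))%R J
    (B + 4 * Rabs (Im v))%R) as [B' HB'].
  - intros j Hj.
    assert (Hre : (Rabs (Re (log_step v j)) <= B * recip j)%R).
    { change (Re (log_step v j)) with (ln (Cmod (v + INR (S j))) - ln (Cmod (v + INR j)))%R.
      pose proof (nonpole_neq_0 v j Hv) as Hn. apply Cmod_gt_0 in Hn.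
      pose proof (nonpole_neq_0 v (S j) Hv) as Hn'. apply Cmod_gt_0 in Hn'.
      assert (E : v + INR (S j) = (v + INR j) + 1) by (rewrite S_INR, RtoC_plus; ring).
      assert (E1 : (Cmod (v + INR (S j)) - Cmod (v + INR j) <= 1)%R).
      { rewrite E. pose proof (Cmod_triangle (v + INR j) 1) as T. rewrite Cmod_1 in T. lra. }
      assert (E2 : (Cmod (v + INR j) - Cmod (v + INR (S j)) <= 1)%R).
      { replace (v + INR j) with (v + INR (S j) + - (1)) by (rewrite E; ring).
        pose proof (Cmod_triangle (v + INR (S j)) (- (1))) as T.
        rewrite Cmod_opp, Cmod_1 in T. lra. }
      pose proof (ln_diff_le _ _ Hn' Hn E1) as L1.
      pose proof (ln_diff_le _ _ Hn Hn' E2) as L2.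
      pose proof (HB j) as b1. pose proof (HB (S j)) as b2. pose proof (recip_S_le j) as b3.
      assert (b4 : (B * recip (S j) <= B * recip j)%R) by now apply Rmult_le_compat_l.
      apply Rabs_le. lra. }
    assert (Hsm : forall i, (J <= i)%nat -> (Rabs (Carg (v + INR i)) <= 2 * Rabs (Im v) * recip i)%R).
    { intros i Hi. specialize (HJ i Hi). pose proof (far_shift v i HJ) as Hf.
      pose proof (pos_INR i). eapply Rle_trans; [apply Carg_small; lra|].
      replace (Im (v + INR i)) with (Im v) by (destruct v; simpl; ring).
      unfold Rdiv, recip.
      replace (2 * Rabs (Im v) * / (INR i + 1))%R
        with (Rabs (Im v) * / (/ 2 * (INR i + 1)))%R by (field; lra).
      apply Rmult_le_compat_l; [apply Rabs_pos|]. apply Rinv_le_contravar; lra. }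
    assert (Him : (Rabs (Im (log_step v j)) <= 4 * Rabs (Im v) * recip j)%R).
    { change (Im (log_step v j)) with (Carg (v + INR (S j)) - Carg (v + INR j))%R.
      pose proof (Hsm j Hj) as h1. pose proof (Hsm (S j) ltac:(lia)) as h2.
      pose proof (recip_S_le j). pose proof (Rabs_pos (Im v)).
      unfold Rminus. eapply Rle_trans; [apply Rabs_triang|]. rewrite Rabs_Ropp. nra. }
    pose proof (Cmod_le_Re_Im (log_step v j)). pose proof (pos_INR j).
    replace (B + 4 * Rabs (Im v))%R
      with ((B * recip j + 4 * Rabs (Im v) * recip j) * (INR j + 1))%R
      by (unfold recip; field; lra).
    apply Rmult_le_compat_r; lra.
  - exists B'. intros j. specialize (HB' j). pose proof (pos_INR j). unfold recip.
    apply Rle_div_r; lra.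
Qed.

(** Comparison with the telescoping differences of [(j + 1)^(1 - sigma)]. *)
Lemma ex_series_recip (sigma : R) : (1 < sigma)%R ->
  ex_series (fun j => exp (- sigma * ln (INR j + 1))).
Proof.
  intros Hs. set (tau := (sigma - 1)%R).
  set (b := fun j => exp (- sigma * ln (INR j + 1))).
  apply ex_series_incr_1.
  apply (ex_series_bounded _ (/ tau)%R); [intros; apply Rlt_le, exp_pos|].
  assert (Htau : (0 < tau)%R) by (unfold tau; lra).
  assert (Hstep : forall j, (tau * b (S j) <=
      exp (- tau * ln (INR j + 1)) - exp (- tau * ln (INR (S j) + 1)))%R).
  { intros j. unfold b. rewrite S_INR. pose proof (pos_INR j) as Hj.
    set (y := (INR j + 1 + 1)%R). set (x := (INR j + 1)%R).
    assert (Hx : (0 < x)%R) by (unfold x; lra).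
    assert (Hy : (0 < y)%R) by (unfold y; lra).
    assert (Hl : (/ y <= ln y - ln x)%R).
    { assert (ln x - ln y <= - / y)%R; [|lra]. rewrite <- ln_div by assumption.
      pose proof (exp_ineq1_le (ln (x / y))) as E.
      rewrite exp_ln in E by now apply Rdiv_lt_0_compat.
      replace (x / y)%R with (1 - / y)%R in E at 2 by (unfold x, y; field; lra). lra. }
    replace (exp (- tau * ln x)) with
      (exp (- tau * ln y) * exp (tau * (ln y - ln x)))%R
      by (rewrite <- exp_plus; f_equal; ring).
    replace (exp (- sigma * ln y)) with (exp (- tau * ln y) * / y)%R.
    - pose proof (exp_ineq1_le (tau * (ln y - ln x))). pose proof (exp_pos (- tau * ln y)).
      assert (tau * / y <= exp (tau * (ln y - ln x)) - 1)%R by nra. nra.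
    - rewrite <- (exp_ln y) at 2 by assumption. rewrite <- exp_Ropp, <- exp_plus.
      f_equal. unfold tau. ring. }
  intros n. apply Rmult_le_reg_l with tau; [assumption|]. rewrite Rinv_r by lra.
  assert (H : (tau * Rsum (fun j => b (S j)) n <= 1 - exp (- tau * ln (INR (S n) + 1)))%R).
  { induction n as [|n IH].
    - rewrite Rsum_0. specialize (Hstep 0%nat).
      replace (exp (- tau * ln (INR 0 + 1))) with 1%R in Hstep; [assumption|].
      simpl INR. rewrite Rplus_0_l, ln_1, Rmult_0_r. now rewrite exp_0.
    - rewrite Rsum_S. specialize (Hstep (S n)). lra. }
  pose proof (exp_pos (- tau * ln (INR (S n) + 1))). lra.
Qed.

(** * Newton's binomial series, uniformly in the exponent *)

(** Radius and centre are arbitrary, so these functions may multiply any local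
    power series. *)
Definition entire (p : C -> C) : Prop :=
  forall s0 r, (0 < r)%R -> exists M, Wnorm_le s0 r M p.

(** The decay is measured in the coefficient norm rather than pointwise in [s],
    so that summing over [j] gives an analytic function at once. *)
Definition bigO (N : nat) (u : nat -> C -> C) : Prop :=
  forall s0 r, (0 < r)%R ->
    exists B, forall j, Wnorm_le s0 r (B * recip j ^ N)%R (u j).

Lemma recip_pow_pos N j : (0 < recip j ^ N)%R.
Proof. apply pow_lt, recip_bounds. Qed.

Lemma bigO_ext N u u' : (forall j s, u j s = u' j s) -> bigO N u -> bigO N u'.
Proof.
  intros E H s0 r Hr. destruct (H s0 r Hr) as [B HB]. exists B. intros j.
  apply Wnorm_ext with (2 := HB j). auto.
Qed.

Lemma bigO_plus N u u' : bigO N u -> bigO N u' -> bigO N (fun j s => u j s + u' j s).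
Proof.
  intros H H' s0 r Hr. destruct (H s0 r Hr) as [B HB], (H' s0 r Hr) as [B' HB'].
  exists (B + B')%R. intros j. rewrite Rmult_plus_distr_r.
  apply Wnorm_plus; [lra|apply HB|apply HB'].
Qed.

Lemma bigO_entire p : entire p -> bigO 0 (fun _ => p).
Proof.
  intros H s0 r Hr. destruct (H s0 r Hr) as [M HM]. exists M. intros j.
  simpl. now rewrite Rmult_1_r.
Qed.

Lemma entire_const a : entire (fun _ => a).
Proof. intros s0 r Hr. exists (Cmod a). apply Wnorm_const. lra. Qed.

Lemma entire_id : entire (fun s => s).
Proof. intros s0 r Hr. eexists. now apply Wnorm_id. Qed.

Lemma entire_plus p q : entire p -> entire q -> entire (fun s => p s + q s).
Proof.
  intros H H' s0 r Hr. destruct (H s0 r Hr), (H' s0 r Hr).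
  eexists. apply Wnorm_plus; [lra|eassumption..].
Qed.

Lemma entire_opp p : entire p -> entire (fun s => - p s).
Proof.
  intros H s0 r Hr. destruct (H s0 r Hr) as [M HM].
  exists (Cmod (- (1)) * M)%R.
  apply Wnorm_ext with (2 := Wnorm_scal s0 r M (- (1)) p HM). intros; ring.
Qed.

Lemma entire_mult p q : entire p -> entire q -> entire (fun s => p s * q s).
Proof.
  intros H H' s0 r Hr. destruct (H s0 r Hr), (H' s0 r Hr).
  eexists. apply Wnorm_mult; [lra|eassumption..].
Qed.

Lemma Csum_head (f : nat -> C) n :
  Csum f (S n) = f 0%nat + Csum (fun i => f (S i)) n :> C.
Proof.
  induction n as [|n IH]; [now rewrite Csum_S, !Csum_0|].
  rewrite Csum_S, IH, (Csum_S (fun i => f (S i))). ring.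
Qed.

(** Horner form makes the degree bound the recursion argument, so that division
    by [s - a] is a plain induction. *)
Fixpoint is_poly (K : nat) (P : C -> C) : Prop :=
  match K with
  | O => exists c, forall s, P s = c
  | S K => exists c Q, is_poly K Q /\ forall s, P s = c + s * Q s
  end.

Lemma is_poly_ext K P Q : (forall s, P s = Q s) -> is_poly K P -> is_poly K Q.
Proof.
  intros E. destruct K as [|K]; simpl.
  - intros [c H]. exists c. intros. now rewrite <- E.
  - intros [c [R [HR H]]]. exists c, R. split; [assumption|]. intros. now rewrite <- E.
Qed.

Lemma is_poly_const K a : is_poly K (fun _ => a).
Proof.
  revert a. induction K as [|K IH]; intros a; simpl.
  - now exists a.
  - exists a, (fun _ => 0). split; [apply IH|]. intros; ring.
Qed.

Lemma is_poly_plus K P Q : is_poly K P -> is_poly K Q -> is_poly K (fun s => P s + Q s).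
Proof.
  revert P Q. induction K as [|K IH]; intros P Q; simpl.
  - intros [a Ha] [b Hb]. exists (a + b). intros. now rewrite Ha, Hb.
  - intros [a [P1 [HP1 Ha]]] [b [Q1 [HQ1 Hb]]].
    exists (a + b), (fun s => P1 s + Q1 s). split; [now apply IH|].
    intros s. rewrite Ha, Hb. ring.
Qed.

Lemma is_poly_scal K a P : is_poly K P -> is_poly K (fun s => a * P s).
Proof.
  revert P. induction K as [|K IH]; intros P; simpl.
  - intros [c Hc]. exists (a * c). intros. now rewrite Hc.
  - intros [c [Q [HQ Hc]]]. exists (a * c), (fun s => a * Q s). split; [now apply IH|].
    intros s. rewrite Hc. ring.
Qed.

Lemma is_poly_mulX K P : is_poly K P -> is_poly (S K) (fun s => s * P s).
Proof. intros H. exists 0, P. split; [assumption|]. intros; ring. Qed.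

Lemma is_poly_S K P : is_poly K P -> is_poly (S K) P.
Proof.
  revert P. induction K as [|K IH]; intros P.
  - intros [c H]. apply is_poly_ext with (fun _ => c); [intros; now rewrite H|].
    apply is_poly_const.
  - intros [c [Q [HQ H]]]. exists c, Q. split; [now apply IH|assumption].
Qed.

Lemma is_poly_Csum (P : nat -> C -> C) K :
  (forall k, is_poly k (P k)) -> is_poly K (fun s => Csum (fun k => P k s) K).
Proof.
  intros H. induction K as [|K IH].
  - apply is_poly_ext with (2 := H 0%nat). intros. now rewrite Csum_0.
  - apply is_poly_ext with (2 := is_poly_plus _ _ _ (is_poly_S _ _ IH) (H (S K))).
    intros. now rewrite Csum_S.
Qed.

Lemma is_poly_division K P a : is_poly (S K) P ->
  exists Q, is_poly K Q /\ forall s, P s = P a + (s - a) * Q s.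
Proof.
  revert P. induction K as [|K IH]; intros P [c [Q0 [HQ0 H]]].
  - exists Q0. split; [assumption|]. destruct HQ0 as [q Hq].
    intros s. rewrite !H, !Hq. ring.
  - destruct (IH Q0 HQ0) as [Q1 [HQ1 H1]].
    exists (fun s => Q0 s + a * Q1 s). split.
    + apply is_poly_plus; [assumption|]. now apply is_poly_S, is_poly_scal.
    + intros s. rewrite !H, (H1 s). ring.
Qed.

(** A polynomial of degree at most [K] is determined by its values at the [K + 1]
    points 0, -1, ..., -K, hence controlled by them in any norm.  The induction
    divides by [s + (K + 1)]; the quotient is at most twice as large at the
    remaining points, because these are at distance at least 1. *)
Lemma interpolation_bound K s0 r : (0 < r)%R ->
  exists A, (0 <= A)%R /\ forall P eps, is_poly K P ->
    (forall i, (i <= K)%nat -> (Cmod (P (- INR i)%C) <= eps)%R) ->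
    Wnorm_le s0 r (A * eps)%R P.
Proof.
  intros Hr. induction K as [|K [A [HA IH]]].
  - exists 1%R. split; [lra|]. intros P eps [c Hc] HP.
    apply Wnorm_ext with (h := fun _ => c); [intros; now rewrite Hc|].
    apply Wnorm_weaken with (r := r) (M := Cmod c); [lra| |apply Wnorm_const; lra].
    specialize (HP 0%nat (le_n _)). rewrite Hc in HP. lra.
  (* [a] is the node removed by the division. *)
  - set (a := - INR (S K)).
    destruct (entire_plus _ _ entire_id (entire_const (- a)) s0 r Hr) as [M HM].
    pose proof (Wnorm_ge_0 _ _ _ _ HM) as HM0.
    exists (1 + M * (A * 2))%R. split; [nra|].
    intros P eps HPK HP.
    destruct (is_poly_division K P a HPK) as [Q [HQ E]].
    assert (HQe : Wnorm_le s0 r (A * (2 * eps))%R Q).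
    { apply IH; [assumption|]. intros i Hi.
      pose proof (HP i ltac:(lia)) as H1. pose proof (HP (S K) (le_n _)) as H2.
      fold a in H2. pose proof (E (- INR i)) as E1.
      assert (Hia : - INR i - a = RtoC (INR (S K) - INR i)).
      { unfold a. rewrite RtoC_minus. ring. }
      rewrite Hia in E1.
      assert (Hle : (1 <= INR (S K) - INR i)%R).
      { rewrite <- minus_INR by lia. apply (le_INR 1). lia. }
      assert (Hb : (Cmod (RtoC (INR (S K) - INR i) * Q (- INR i))%C <= 2 * eps)%R).
      { replace (RtoC (INR (S K) - INR i) * Q (- INR i)) with (P (- INR i) + - P a)
          by (rewrite E1; ring).
        eapply Rle_trans; [apply Cmod_triangle|]. rewrite Cmod_opp. lra. }
      rewrite Cmod_mult, Cmod_R, Rabs_pos_eq in Hb by lra.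
      pose proof (Cmod_ge_0 (Q (- INR i))). nra. }
    apply Wnorm_ext with (h := fun s => P a + (s + - a) * Q s).
    { intros s _. rewrite (E s). ring. }
    replace ((1 + M * (A * 2)) * eps)%R with (eps + M * (A * (2 * eps)))%R by ring.
    apply Wnorm_plus; [lra| |now apply Wnorm_mult].
    apply Wnorm_weaken with (r := r) (M := Cmod (P a)); [lra|apply HP; lia|].
    apply Wnorm_const. lra.
Qed.

(** The binomial coefficient of [- s] over [n], so that formally
    [(1 + y)^(- s)] is the sum of [negbinom n s * y ^ n]. *)
Fixpoint negbinom (n : nat) (s : C) : C :=
  match n with
  | O => 1
  | S n => negbinom n s * ((- s - INR n) * (/ INR (S n))%R)
  end.

Lemma RtoC_INR_inv n : RtoC (/ INR (S n)) = / RtoC (INR (S n)).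
Proof. apply RtoC_inv. apply not_0_INR. lia. Qed.

Lemma INR_S_neq_0 n : RtoC (INR (S n)) <> 0.
Proof.
  intros E. apply (not_0_INR (S n)); [lia|]. now injection E.
Qed.

Lemma negbinom_pascal n s :
  negbinom (S n) (s - 1) = negbinom (S n) s + negbinom n s.
Proof.
  induction n as [|n IH].
  - simpl. rewrite Rinv_1. ring.
  - change (negbinom (S (S n)) (s - 1)) with
      (negbinom (S n) (s - 1) * ((- (s - 1) - INR (S n)) * (/ INR (S (S n)))%R)).
    rewrite IH.
    change (negbinom (S (S n)) s) with
      (negbinom (S n) s * ((- s - INR (S n)) * (/ INR (S (S n)))%R)).
    change (negbinom (S n) s) with (negbinom n s * ((- s - INR n) * (/ INR (S n))%R)).
    rewrite !RtoC_INR_inv. pose proof (INR_S_neq_0 n) as H1. pose proof (INR_S_neq_0 (S n)) as H2.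
    rewrite (S_INR (S n)) in *. rewrite (S_INR n) in *. rewrite !RtoC_plus in *. field. auto.
Qed.

Lemma negbinom_vanishes n i : (i < n)%nat -> negbinom n (- INR i) = 0.
Proof.
  induction n as [|n IH]; intros H; [lia|]. simpl negbinom.
  destruct (Nat.eq_dec i n) as [->|Hne].
  - ring.
  - rewrite IH by lia. ring.
Qed.

(** At [s = - i] the series stops after [i + 1] terms: it is the binomial
    theorem, obtained from Pascal's rule by induction on [i]. *)
Lemma negbinom_theorem K i y : (i <= K)%nat ->
  Csum (fun n => negbinom n (- INR i) * y ^ n) K = (1 + y) ^ i :> C.
Proof.
  induction i as [|i IH]; intros Hi.
  - destruct K as [|K].
    + rewrite Csum_0. simpl. ring.
    + rewrite Csum_head.
      rewrite (Csum_ext _ (fun _ => 0 * 0) K).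
      * rewrite (Csum_scal 0 (fun _ => RtoC 0)). simpl. ring.
      * intros k _. rewrite (negbinom_vanishes (S k) 0) by lia. ring.
  - destruct K as [|K]; [lia|].
    rewrite Cpow_S, <- IH by lia. rewrite Cmult_plus_distr_r, Cmult_1_l.
    rewrite (Csum_S (fun n => negbinom n (- INR i) * y ^ n)) at 2.
    rewrite (negbinom_vanishes (S K) i) by lia.
    rewrite !Csum_head.
    replace (- INR (S i)) with (- INR i - 1) by (rewrite S_INR, RtoC_plus; ring).
    rewrite (Csum_ext _ (fun k => negbinom (S k) (- INR i) * y ^ S k
                                  + y * (negbinom k (- INR i) * y ^ k)) K).
    + rewrite Csum_plus, (Csum_scal y). simpl. ring.
    + intros k _. rewrite negbinom_pascal, Cpow_S. ring.
Qed.

Lemma negbinom_is_poly n : is_poly n (negbinom n).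
Proof.
  induction n as [|n IH]; [now exists 1|].
  apply is_poly_ext with (fun s =>
    - (/ INR (S n))%R * (s * negbinom n s) + - (INR n * (/ INR (S n))%R) * negbinom n s).
  - intros s. change (negbinom (S n) s) with (negbinom n s * ((- s - INR n) * (/ INR (S n))%R)).
    ring.
  - apply is_poly_plus; apply is_poly_scal; [now apply is_poly_mulX|now apply is_poly_S].
Qed.

Lemma negbinom_entire n : entire (negbinom n).
Proof.
  induction n as [|n IH]; [apply entire_const|].
  apply (entire_mult (negbinom n)); [assumption|].
  apply (entire_mult (fun s => - s - INR n)); [|apply entire_const].
  apply (entire_plus (fun s => - s)); [|apply entire_const].
  apply (entire_opp (fun s => s)), entire_id.
Qed.

Lemma bigO_exp_tail (d : nat -> C) (B : R) (K : nat) :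
  (forall j, (Cmod (d j) <= B * recip j)%R) ->
  bigO (S K) (fun j s => Cexp (- s * d j) - Csum (exp_term (- s * d j)) K).
Proof.
  intros hd s0 r Hr.
  set (R0 := (Cmod s0 + r)%R).
  assert (HB : (0 <= B)%R).
  { pose proof (hd 0%nat). pose proof (Cmod_ge_0 (d 0%nat)). pose proof (recip_bounds 0). nra. }
  assert (HR0 : (0 <= R0)%R) by (unfold R0; pose proof (Cmod_ge_0 s0); lra).
  exists ((R0 * B) ^ S K * exp (R0 * B))%R. intros j.
  pose proof (recip_bounds j) as Hq.
  assert (Hh : Wnorm_le s0 r (R0 * B * recip j)%R (fun s => - s * d j)).
  { apply Wnorm_ext with (h := fun s => - d j * s); [intros; ring|].
    apply Wnorm_weaken with (3 := Wnorm_scal s0 r _ (- d j) _ (Wnorm_id s0 r Hr)); [lra|].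
    rewrite Cmod_opp. fold R0. specialize (hd j). nra. }
  apply Wnorm_weaken with (3 := Wnorm_exp_tail s0 r _ _ K Hr Hh); [lra|].
  rewrite Rpow_mult_distr.
  assert (0 <= (R0 * B) ^ S K)%R by (apply pow_le; nra).
  pose proof (recip_pow_pos (S K) j).
  assert (exp (R0 * B * recip j) <= exp (R0 * B))%R.
  { apply exp_mono. assert (0 <= R0 * B)%R by nra. nra. }
  assert (0 <= (R0 * B) ^ S K * recip j ^ S K)%R by nra. nra.
Qed.

(** Newton's binomial series for [(1 + x)^(- s) = Cexp (- s * d)], with a
    remainder that is uniform in [s].  The Taylor polynomial of the exponential
    approximates the left side to the required order, so it remains to compare
    two polynomials of degree [K] in [s].  At [s = 0, -1, ..., -K] the binomial
    sum is exact, so there their difference is just a Taylor remainder, and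
    interpolation makes it small everywhere. *)
Lemma newton_expansion (x d : nat -> C) (B : R) (K : nat) :
  (forall j, (Cmod (d j) <= B * recip j)%R) ->
  (forall j, Cexp (d j) = 1 + x j) ->
  bigO (S K) (fun j s => Cexp (- s * d j) - Csum (fun n => negbinom n s * x j ^ n) K).
Proof.
  intros hd hdx.
  apply bigO_ext with (fun j s =>
    (Cexp (- s * d j) - Csum (exp_term (- s * d j)) K)
    + (Csum (exp_term (- s * d j)) K - Csum (fun n => negbinom n s * x j ^ n) K)).
  { intros; ring. }
  apply bigO_plus; [now apply (bigO_exp_tail d B)|].
  intros s0 r Hr. destruct (interpolation_bound K s0 r Hr) as [A [HA HP]].
  pose proof (pos_INR K) as HK.
  (* A disc around 0 that contains all the nodes 0, -1, ..., -K. *)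
  destruct (bigO_exp_tail d B K hd 0 (INR K + 1)%R ltac:(lra)) as [B0 HB0].
  exists (A * B0)%R. intros j. rewrite Rmult_assoc. apply HP.
  - apply is_poly_ext with (fun s =>
      Csum (fun n => (- d j) ^ n * (/ INR (fact n))%R * s ^ n + - (x j ^ n) * negbinom n s) K).
    + intros s. rewrite Csum_plus.
      rewrite (Csum_ext (fun n => - (x j ^ n) * negbinom n s)
                 (fun n => - (negbinom n s * x j ^ n))) by (intros; ring).
      rewrite Csum_opp.
      rewrite (Csum_ext (fun n => (- d j) ^ n * (/ INR (fact n))%R * s ^ n)
                 (exp_term (- s * d j))); [ring|].
      intros n _. unfold exp_term. replace (- s * d j) with (- d j * s) by ring.
      rewrite Cpow_mult_l. ring.
    + apply is_poly_Csum. intros n. apply is_poly_plus; apply is_poly_scal.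
      * induction n as [|n IHn]; [now exists 1|]. now apply (is_poly_mulX n (fun s => s ^ n)).
      * apply negbinom_is_poly.
  - intros i Hi.
    assert (E : Cexp (- - INR i * d j) = (1 + x j) ^ i).
    { rewrite <- hdx, <- Cexp_mult_INR. f_equal. ring. }
    rewrite negbinom_theorem, <- E by assumption.
    pose proof (Wnorm_bound _ _ _ _ (- INR i) (HB0 j)) as Hb. simpl in Hb.
    match goal with |- (Cmod (?a - ?b) <= _)%R => replace (a - b) with (- (b - a)) by ring end.
    rewrite Cmod_opp. apply Hb.
    replace (- INR i - 0) with (- INR i) by ring. rewrite Cmod_opp, Cmod_R, Rabs_pos_eq by apply pos_INR.
    apply le_INR in Hi. lra.
Qed.

(** * Analytic functions and the identity theorem *)

Lemma is_pseries_Cseries (c : nat -> C) (w l : C) :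
  @is_pseries C_AbsRing C_NormedModule c w l <-> Cseries (fun k => c k * w ^ k) l.
Proof.
  assert (E : forall k, @pow_n C_AbsRing w k = w ^ k).
  { induction k as [|k IH]; [reflexivity|]. simpl. now rewrite IH. }
  assert (E' : forall k, @scal C_AbsRing C_NormedModule (@pow_n C_AbsRing w k) (c k)
                       = c k * w ^ k).
  { intros k. rewrite E. apply Cmult_comm. }
  unfold is_pseries. split; apply Cseries_ext; auto.
Qed.

Lemma Wnorm_analytic s0 r M h : (0 < r)%R -> Wnorm_le s0 r M h -> C_analytic_at h s0.
Proof.
  intros Hr [c [_ Hs]]. exists c, r. split; [assumption|].
  intros s H. apply is_pseries_Cseries. now apply Hs.
Qed.

Lemma Cseries_bounded_terms (a : nat -> C) l :
  Cseries a l -> exists B, forall n, (Cmod (a n) <= B)%R.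
Proof.
  intros H.
  destruct (@filterlim_bounded C_AbsRing C_NormedModule (sum_n a)) as [M HM].
  { exists l. exact H. }
  change (forall n, (Cmod (Csum a n) <= M)%R) in HM.
  exists (2 * M)%R. intros [|n].
  - specialize (HM 0%nat). rewrite Csum_0 in HM. pose proof (Cmod_ge_0 (a 0%nat)). lra.
  - pose proof (HM n) as H1. pose proof (HM (S n)) as H2. rewrite Csum_S in H2.
    replace (a (S n)) with ((Csum a n + a (S n)) + - Csum a n) by ring.
    eapply Rle_trans; [apply Cmod_triangle|]. rewrite Cmod_opp. lra.
Qed.

(** Convergence at a point at distance [r / 2] bounds the coefficients
    geometrically, so the norm of radius [r / 4] is finite. *)
Lemma analytic_Wnorm F s0 : C_analytic_at F s0 ->
  exists r M, (0 < r)%R /\ Wnorm_le s0 r M F.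
Proof.
  intros [c [r [Hr Hc]]].
  assert (Hc' : forall s, (Cmod (s - s0) < r)%R -> Cseries (fun k => c k * (s - s0) ^ k) (F s)).
  { intros s Hs. apply is_pseries_Cseries. now apply Hc. }
  assert (Hmid : (Cmod (s0 + (r / 2)%R - s0) < r)%R).
  { replace (s0 + (r / 2)%R - s0) with (RtoC (r / 2)) by ring.
    rewrite Cmod_R, Rabs_pos_eq; lra. }
  destruct (Cseries_bounded_terms _ _ (Hc' _ Hmid)) as [B HB].
  exists (r / 4)%R, (2 * B)%R. split; [lra|]. exists c. split.
  - assert (HB' : forall k, (Cmod (c k) * (r / 4) ^ k <= B * (/ 2) ^ k)%R).
    { intros k. specialize (HB k).
      replace (s0 + (r / 2)%R - s0) with (RtoC (r / 2)) in HB by ring.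
      rewrite Cmod_mult, Cmod_pow, Cmod_R, Rabs_pos_eq in HB by lra.
      replace (r / 4)%R with (r / 2 * / 2)%R by field.
      rewrite Rpow_mult_distr, <- Rmult_assoc.
      apply Rmult_le_compat_r; [apply pow_le; lra|assumption]. }
    intros K. apply Rle_trans with (2 * B - B * (/ 2) ^ K)%R.
    + induction K as [|K IH].
      * rewrite Rsum_0. specialize (HB' 0%nat). simpl in *. lra.
      * rewrite Rsum_S. specialize (HB' (S K)). simpl in *. lra.
    + assert (0 <= B)%R by (eapply Rle_trans; [apply Cmod_ge_0|apply (HB 0%nat)]).
      pose proof (pow_le (/ 2) K ltac:(lra)). nra.
  - intros s Hs. apply Hc'. lra.
Qed.

Lemma analytic_local F G s0 rho : (0 < rho)%R ->
  (forall s, (Cmod (s - s0) < rho)%R -> F s = G s) ->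
  C_analytic_at F s0 -> C_analytic_at G s0.
Proof.
  intros Hrho E [c [r [Hr Hc]]]. exists c, (Rmin r rho). split.
  - now apply Rmin_glb_lt.
  - intros s Hs. pose proof (Rmin_l r rho). pose proof (Rmin_r r rho).
    rewrite <- E by lra. apply Hc. lra.
Qed.

Lemma analytic_ext F G s0 : (forall s, F s = G s) ->
  C_analytic_at F s0 -> C_analytic_at G s0.
Proof. intros E. apply (analytic_local F G s0 1); [lra|auto]. Qed.

Lemma analytic_Wnorm2 F G s0 : C_analytic_at F s0 -> C_analytic_at G s0 ->
  exists r M M', (0 < r)%R /\ Wnorm_le s0 r M F /\ Wnorm_le s0 r M' G.
Proof.
  intros HF HG. destruct (analytic_Wnorm F s0 HF) as [r [M [Hr H]]].
  destruct (analytic_Wnorm G s0 HG) as [r' [M' [Hr' H']]].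
  pose proof (Rmin_l r r'). pose proof (Rmin_r r r'). pose proof (Rmin_glb_lt _ _ _ Hr Hr').
  exists (Rmin r r'), M, M'. split; [assumption|].
  split; [apply Wnorm_weaken with (3 := H)|apply Wnorm_weaken with (3 := H')]; lra.
Qed.

Lemma analytic_plus F G s0 : C_analytic_at F s0 -> C_analytic_at G s0 ->
  C_analytic_at (fun s => F s + G s) s0.
Proof.
  intros HF HG. destruct (analytic_Wnorm2 F G s0 HF HG) as (r & M & M' & Hr & H & H').
  apply (Wnorm_analytic s0 r (M + M')); [assumption|]. apply Wnorm_plus; [lra|assumption..].
Qed.

Lemma analytic_mult F G s0 : C_analytic_at F s0 -> C_analytic_at G s0 ->
  C_analytic_at (fun s => F s * G s) s0.
Proof.
  intros HF HG. destruct (analytic_Wnorm2 F G s0 HF HG) as (r & M & M' & Hr & H & H').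
  apply (Wnorm_analytic s0 r (M * M')); [assumption|]. now apply Wnorm_mult.
Qed.

Lemma entire_analytic p s0 : entire p -> C_analytic_at p s0.
Proof.
  intros H. destruct (H s0 1%R ltac:(lra)) as [M HM].
  apply (Wnorm_analytic s0 1 M); [lra|assumption].
Qed.

Lemma entire_exp p : entire p -> entire (fun s => Cexp (p s)).
Proof.
  intros H s0 r Hr. destruct (H s0 r Hr) as [M HM]. exists (exp M). now apply Wnorm_exp.
Qed.

Lemma analytic_scal a F s0 : C_analytic_at F s0 -> C_analytic_at (fun s => a * F s) s0.
Proof. apply (analytic_mult (fun _ => a)). apply entire_analytic, entire_const. Qed.

Lemma analytic_minus F G s0 : C_analytic_at F s0 -> C_analytic_at G s0 ->
  C_analytic_at (fun s => F s - G s) s0.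
Proof.
  intros HF HG. apply analytic_ext with (fun s => F s + - (1) * G s).
  - intros; ring.
  - apply analytic_plus; [assumption|]. now apply analytic_scal.
Qed.

Lemma analytic_Csum (F : nat -> C -> C) s0 K :
  (forall k, C_analytic_at (F k) s0) -> C_analytic_at (fun s => Csum (fun k => F k s) K) s0.
Proof.
  intros H. induction K as [|K IH].
  - apply analytic_ext with (2 := H 0%nat). intros. now rewrite Csum_0.
  - apply analytic_ext with (2 := analytic_plus _ _ _ IH (H (S K))).
    intros. now rewrite Csum_S.
Qed.

Lemma analytic_translate F s0 a : C_analytic_at F (s0 + a) ->
  C_analytic_at (fun s => F (s + a)) s0.
Proof.
  intros [c [r [Hr Hc]]]. exists c, r. split; [assumption|]. intros s Hs.
  replace (s - s0) with (s + a - (s0 + a)) in * by ring. now apply Hc.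
Qed.

Lemma Cgeom_series (q : C) : (Cmod q < 1)%R -> Cseries (fun k => q ^ k) (/ (1 - q)).
Proof.
  intros Hq.
  assert (H1 : 1 - q <> 0).
  { intros E. assert (q = 1) by (replace q with (1 - (1 - q)) by ring; rewrite E; ring).
    subst q. rewrite Cmod_1 in Hq. lra. }
  assert (Hs : forall n, Csum (fun k => q ^ k) n = (1 - q ^ S n) * / (1 - q) :> C).
  { induction n as [|n IH]; rewrite ?Csum_S, ?Csum_0, ?IH; simpl; field; assumption. }
  apply Cseries_eps. intros eps He.
  assert (Hm : (0 < Cmod (1 - q))%R) by now apply Cmod_gt_0.
  destruct (pow_lt_1_zero (Cmod q)) with (y := (eps * Cmod (1 - q))%R) as [N HN].
  - rewrite Rabs_pos_eq; [assumption|apply Cmod_ge_0].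
  - nra.
  - exists N. intros n Hn. rewrite Hs.
    replace ((1 - q ^ S n) * / (1 - q) - / (1 - q)) with (- (q ^ S n / (1 - q))) by (field; assumption).
    rewrite Cmod_opp, Cmod_div, Cmod_pow by assumption.
    specialize (HN (S n) ltac:(lia)). rewrite Rabs_pos_eq in HN by apply pow_le, Cmod_ge_0.
    apply Rlt_div_l; assumption.
Qed.

Lemma analytic_inv a s0 : s0 <> a -> C_analytic_at (fun s => / (s - a)) s0.
Proof.
  intros Hne.
  assert (H0 : s0 - a <> 0).
  { intros E. apply Hne. replace s0 with (s0 - a + a) by ring. rewrite E. ring. }
  assert (Hm : (0 < Cmod (s0 - a))%R) by now apply Cmod_gt_0.
  exists (fun k => / (s0 - a) * (- / (s0 - a)) ^ k), (Cmod (s0 - a)). split; [assumption|].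
  intros s Hs. apply is_pseries_Cseries.
  set (q := - / (s0 - a) * (s - s0)).
  assert (Hq : (Cmod q < 1)%R).
  { unfold q. rewrite Cmod_mult, Cmod_opp, Cmod_inv by assumption.
    rewrite Rmult_comm. apply Rlt_div_l; lra. }
  assert (E : s - a = (s0 - a) * (1 - q)) by (unfold q; field; assumption).
  assert (H1 : 1 - q <> 0).
  { intros Hz. assert (q = 1) by (replace q with (1 - (1 - q)) by ring; rewrite Hz; ring).
    rewrite H in Hq. rewrite Cmod_1 in Hq. lra. }
  rewrite E. replace (/ ((s0 - a) * (1 - q))) with (/ (s0 - a) * / (1 - q)) by (field; auto).
  apply Cseries_ext with (2 := Cseries_scal (/ (s0 - a)) _ _ (Cgeom_series q Hq)).
  intros k. unfold q. rewrite Cpow_mult_l. ring.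
Qed.

(** If [c k] is the first nonzero coefficient, then at a zero [s] close to [s0]
    the term of index [k] is balanced by the later ones, which are smaller by a
    factor of order [Cmod (s - s0)]; arbitrarily close zeros force [c k = 0]. *)
Lemma analytic_zeros_isolated (D : C -> C) (s0 : C) : C_analytic_at D s0 ->
  (forall eps, (0 < eps)%R -> exists s, (0 < Cmod (s - s0) < eps)%R /\ D s = 0) ->
  exists rho, (0 < rho)%R /\ forall s, (Cmod (s - s0) < rho)%R -> D s = 0.
Proof.
  intros HD Hz. destruct (analytic_Wnorm D s0 HD) as [r [M [Hr [c [Hc Hs]]]]].
  assert (Hc0 : forall k, c k = 0).
  { intros k. induction k as [k IH] using (well_founded_induction Wf_nat.lt_wf).
    apply Cmod_eq_0. apply Rle_antisym; [|apply Cmod_ge_0].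
    apply Rnot_lt_le. intros Hck.
    assert (HM : (0 <= M)%R) by (apply (Wnorm_ge_0 s0 r M D); now exists c).
    pose proof (pow_lt r (S k) Hr) as HrS.
    set (eps := Rmin r (Cmod (c k) * r ^ S k / (M + 1))%R).
    assert (Heps : (0 < eps)%R).
    { apply Rmin_glb_lt; [assumption|]. apply Rdiv_lt_0_compat; nra. }
    destruct (Hz eps Heps) as [s [[Hw0 Hw] HDs]].
    assert (Hwr : (Cmod (s - s0) < r)%R) by (eapply Rlt_le_trans; [exact Hw|apply Rmin_l]).
    assert (Hwc : (Cmod (s - s0) < Cmod (c k) * r ^ S k / (M + 1))%R)
      by (eapply Rlt_le_trans; [exact Hw|apply Rmin_r]).
    set (w := s - s0) in *.
    pose proof (Hs s Hwr) as Hser. rewrite HDs in Hser. fold w in Hser.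
    (* [e] isolates the term of index [k]; subtracting it leaves the later terms. *)
    set (e := fun i => if Nat.eq_dec i k then c k * w ^ k else 0).
    assert (He : Cseries e (c k * w ^ k)).
    { apply Cseries_eps. intros e0 He0. exists k. intros n Hn.
      assert (E : Csum e n = c k * w ^ k :> C).
      { assert (Hlt : forall n, (n < k)%nat -> Csum e n = 0 :> C).
        { clear n Hn. induction n as [|n IHn]; intros Hn; rewrite ?Csum_S, ?Csum_0;
            [|rewrite IHn by lia]; unfold e; destruct Nat.eq_dec; try lia; ring. }
        clear - Hn Hlt. induction n as [|n IHn].
        - rewrite Csum_0. unfold e. destruct Nat.eq_dec; [reflexivity|lia].
        - rewrite Csum_S. destruct (Nat.eq_dec (S n) k) as [E|E].
          + rewrite Hlt by lia. unfold e. destruct Nat.eq_dec; [ring|lia].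
          + rewrite IHn by lia. unfold e at 1. destruct Nat.eq_dec; [lia|ring]. }
      rewrite E. replace (c k * w ^ k - c k * w ^ k) with (RtoC 0) by ring.
      rewrite Cmod_0. assumption. }
    pose proof (Cseries_minus _ _ _ _ Hser He) as Hdiff.
    set (q := (Cmod w / r)%R).
    assert (Hq : (0 <= q)%R) by (apply Rdiv_le_0_compat; [apply Cmod_ge_0|assumption]).
    assert (Hq1 : (q <= 1)%R) by (apply Rle_div_l; lra).
    assert (Hbound : (Cmod (0 - c k * w ^ k) <= q ^ S k * M)%R).
    { apply Cseries_norm_le with (1 := Hdiff). intros n.
      eapply Rle_trans; [apply Cmod_Csum_le|].
      apply Rle_trans with (q ^ S k * Rsum (fun i => Cmod (c i) * r ^ i) n)%R.
      - apply Rle_trans with (Rsum (fun i => q ^ S k * (Cmod (c i) * r ^ i))%R n).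
        + apply Rsum_le. intros i _. unfold e. destruct (Nat.eq_dec i k) as [->|Hik].
          * replace (c k * w ^ k - c k * w ^ k) with (RtoC 0) by ring. rewrite Cmod_0.
            apply Rmult_le_pos; [now apply pow_le|apply Wnorm_term_ge_0; lra].
          * destruct (lt_dec i k) as [Hlt|Hge].
            -- rewrite (IH i Hlt). replace (0 * w ^ i - 0) with (RtoC 0) by ring. rewrite Cmod_0.
               rewrite Rmult_0_l, Rmult_0_r. lra.
            -- replace (c i * w ^ i - 0) with (c i * w ^ i) by ring.
               rewrite Cmod_mult, Cmod_pow.
               replace (Cmod w) with (q * r)%R by (unfold q; field; lra).
               rewrite Rpow_mult_distr.
               replace (q ^ S k * (Cmod (c i) * r ^ i))%R
                 with (Cmod (c i) * (q ^ S k * r ^ i))%R by ring.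
               apply Rmult_le_compat_l; [apply Cmod_ge_0|].
               apply Rmult_le_compat_r; [apply pow_le; lra|].
               replace i with (S k + (i - S k))%nat at 1 by lia. rewrite pow_add.
               rewrite <- (Rmult_1_r (q ^ S k)) at 2.
               apply Rmult_le_compat_l; [now apply pow_le|].
               rewrite <- (pow1 (i - S k)). apply pow_incr. lra.
        + apply Req_le. clear. induction n as [|n IHn]; rewrite ?Rsum_S, ?Rsum_0, ?IHn; ring.
      - apply Rmult_le_compat_l; [now apply pow_le|apply Hc]. }
    replace (0 - c k * w ^ k) with (- (c k * w ^ k)) in Hbound by ring.
    rewrite Cmod_opp, Cmod_mult, Cmod_pow in Hbound.
    assert (Hwk : (0 < Cmod w ^ k)%R) by now apply pow_lt.
    assert (E : (q ^ S k * M = Cmod w ^ k * (Cmod w * M / r ^ S k))%R).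
    { unfold q, Rdiv. rewrite Rpow_mult_distr, pow_inv. simpl. ring. }
    rewrite E, Rmult_comm in Hbound. apply Rmult_le_reg_l in Hbound; [|assumption].
    apply Rlt_div_r in Hwc; [|lra]. apply Rle_div_r in Hbound; [|lra].
    nra. }
  exists r. split; [assumption|]. intros s Hsr.
  apply Cseries_unique with (1 := Hs s Hsr).
  replace (RtoC 0) with (c 0%nat * (s - s0) ^ 0) by (rewrite Hc0; ring).
  apply (Cseries_single (fun k => c k * (s - s0) ^ k)). intros k. rewrite Hc0. ring.
Qed.

(** Let [m] be the supremum of the parameters up to which [D] vanishes on the
    segment.  The zeros accumulate at the point of parameter [m], so [D]
    vanishes around it, and [m] cannot be less than 1. *)
Lemma identity_along_segment (D : C -> C) (w s : C) (x0 : R) :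
  w <> s -> (0 < x0)%R ->
  (forall x, (0 <= x <= 1)%R -> C_analytic_at D (w + x * (s - w))) ->
  (forall x, (0 <= x <= x0)%R -> D (w + x * (s - w)) = 0) ->
  D s = 0.
Proof.
  intros Hws Hx0 HD H0.
  set (g := fun x : R => w + x * (s - w)).
  assert (Hd : (0 < Cmod (s - w))%R).
  { apply Cmod_gt_0. intros E. apply Hws. replace s with (s - w + w) by ring. rewrite E. ring. }
  assert (Hg : forall x y, Cmod (g x - g y) = (Rabs (x - y) * Cmod (s - w))%R).
  { intros x y. unfold g.
    replace (w + x * (s - w) - (w + y * (s - w))) with ((x - y)%R * (s - w))
      by (rewrite RtoC_minus; ring).
    now rewrite Cmod_mult, Cmod_R. }
  set (E := fun x : R => (x <= 1)%R /\ forall y, (0 <= y <= x)%R -> D (g y) = 0).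
  destruct (completeness E) as [m [Hub Hlub]].
  - exists 1%R. intros x [Hx _]. assumption.
  - exists 0%R. split; [lra|]. intros y Hy. apply H0. lra.
  - assert (Hm0 : (0 < m)%R).
    { apply Rlt_le_trans with (Rmin x0 1); [apply Rmin_glb_lt; lra|].
      apply Hub. split; [apply Rmin_r|]. intros y Hy. apply H0.
      pose proof (Rmin_l x0 1). lra. }
    assert (Hm1 : (m <= 1)%R) by (apply Hlub; intros x [Hx _]; assumption).
    assert (Hbelow : forall x, (0 <= x < m)%R -> D (g x) = 0).
    { intros x Hx. apply NNPP. intros Hne.
      assert (Hle : (m <= x)%R); [|lra].
      apply Hlub. intros e [He1 He]. apply Rnot_lt_le. intros Hlt.
      apply Hne, He. lra. }
    destruct (analytic_zeros_isolated D (g m)) as [rho [Hrho Hzero]].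
    + apply HD. lra.
    + intros eps Heps. set (h := Rmin (m / 2) (eps / (2 * Cmod (s - w)))).
      assert (Hh : (0 < h)%R).
      { apply Rmin_glb_lt; [lra|apply Rdiv_lt_0_compat; lra]. }
      assert (Hh1 : (h <= m / 2)%R) by apply Rmin_l.
      assert (Hh2 : (h <= eps / (2 * Cmod (s - w)))%R) by apply Rmin_r.
      apply Rle_div_r in Hh2; [|lra].
      exists (g (m - h)%R). rewrite Hg.
      replace (m - h - m)%R with (- h)%R by ring. rewrite Rabs_Ropp, Rabs_pos_eq by lra.
      split; [split; nra|]. apply Hbelow. lra.
    + destruct (Rle_lt_or_eq_dec m 1 Hm1) as [Hlt|Heq].
      * exfalso. set (h := Rmin (1 - m) (rho / (2 * Cmod (s - w)))).
        assert (Hh : (0 < h)%R).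
        { apply Rmin_glb_lt; [lra|apply Rdiv_lt_0_compat; lra]. }
        assert (Hh1 : (h <= 1 - m)%R) by apply Rmin_l.
        assert (Hh2 : (h <= rho / (2 * Cmod (s - w)))%R) by apply Rmin_r.
        apply Rle_div_r in Hh2; [|lra].
        assert (HE : E (m + h)%R).
        { split; [lra|]. intros y Hy. destruct (Rlt_dec y m) as [Hym|Hym].
          - apply Hbelow. lra.
          - apply Hzero. rewrite Hg, Rabs_pos_eq by lra. nra. }
        specialize (Hub _ HE). lra.
      * replace s with (g m).
        -- apply Hzero. rewrite Hg, Rminus_diag, Rabs_R0. lra.
        -- unfold g. rewrite Heq. ring.
Qed.

(** The point [s] is joined to a point of real part 2 whose imaginary part is
    one unit further from the real axis.  The segment meets the real axis at most
    at [s] and so avoids the singularity 1, and its real parts never fall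
    below that of [s]. *)
Lemma identity_halfplane (D : C -> C) (s : C) :
  (forall u, (1 < Re u)%R -> D u = 0) ->
  (forall u, (Re s <= Re u)%R -> (u = 1 -> s = 1) -> C_analytic_at D u) ->
  D s = 0.
Proof.
  intros H1 HD. destruct (Rlt_dec 1 (Re s)) as [Hs|Hs]; [now apply H1|].
  apply Rnot_lt_le in Hs. destruct s as [a b]. simpl in Hs.
  (* The direction away from the real axis. *)
  set (sg := if Rle_dec 0 b then 1%R else (-1)%R).
  set (w := (2, b + sg)%R : C).
  assert (Hg : forall x : R, w + x * ((a, b) - w) = ((2 + x * (a - 2))%R, (b + (1 - x) * sg)%R)).
  { intros x. unfold w. apply injective_projections; simpl; ring. }
  apply (identity_along_segment D w (a, b) (/ (3 - a))%R).
  - intros E. injection E. intros. lra.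
  - apply Rinv_0_lt_compat. lra.
  - intros x Hx. rewrite Hg. apply HD.
    + simpl. simpl in HD. nra.
    + intros E. injection E. intros E2 E1.
      assert (Hx1 : x = 1%R).
      { unfold sg in E2. destruct (Rle_dec 0 b) as [Hb|Hb]; nra. }
      subst x. apply injective_projections; simpl; [lra|].
      rewrite <- E2. ring.
  - intros x Hx. rewrite Hg. apply H1. simpl.
    assert (x * (3 - a) <= 1)%R.
    { apply Rle_trans with (/ (3 - a) * (3 - a))%R; [apply Rmult_le_compat_r; lra|].
      rewrite Rinv_l; lra. }
    nra.
Qed.

(** * Continuation of the Lerch series on the unit circle *)

Lemma lerch_term_exp z s v j : lerch_term z s v j = Cexp (- s * shift_log v j) * z ^ j.
Proof. reflexivity. Qed.

Lemma recip_pow_exp N j : (recip j ^ N)%R = exp (- INR N * ln (INR j + 1)).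
Proof.
  pose proof (pos_INR j). unfold recip.
  induction N as [|N IH]; [simpl; rewrite Ropp_0, Rmult_0_l, exp_0; reflexivity|].
  rewrite <- tech_pow_Rmult, IH, S_INR.
  replace (- (INR N + 1) * ln (INR j + 1))%R
    with (- ln (INR j + 1) + - INR N * ln (INR j + 1))%R by ring.
  rewrite exp_plus, exp_Ropp, exp_ln by lra. reflexivity.
Qed.

Lemma ln_INR_S_ge_0 j : (0 <= ln (INR j + 1))%R.
Proof.
  pose proof (pos_INR j). rewrite <- ln_1. apply ln_le; lra.
Qed.

Lemma shift_log_growth v : nonpole v -> exists B, (0 <= B)%R /\ forall j,
  (Rabs (Re (shift_log v j) - ln (INR j + 1)) <= B)%R /\
  (Cmod (shift_log v j) <= ln (INR j + 1) + B)%R.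
Proof.
  intros Hv. destruct (log_growth v Hv) as [B HB].
  assert (HB0 : (0 <= B)%R) by (eapply Rle_trans; [apply Rabs_pos|apply (HB 0%nat)]).
  pose proof PI_RGT_0.
  exists (B + PI)%R. split; [lra|]. intros j. specialize (HB j).
  change (Re (shift_log v j)) with (ln (Cmod (v + INR j))).
  split; [lra|].
  pose proof (Cmod_le_Re_Im (shift_log v j)) as H1.
  change (Re (shift_log v j)) with (ln (Cmod (v + INR j))) in H1.
  change (Im (shift_log v j)) with (Carg (v + INR j)) in H1.
  pose proof (Carg_bound (v + INR j)). pose proof (ln_INR_S_ge_0 j) as HL.
  apply Rabs_le_between in HB.
  assert (Rabs (ln (Cmod (v + INR j))) <= ln (INR j + 1) + B)%R; [|lra].
  apply Rabs_le. lra.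
Qed.

(** On a disc of radius [r] the term is of order [(j + 1)^(- Re s0 + r)]: the
    radius costs only a power that can be made as small as desired. *)
Lemma lerch_term_Wnorm z v s0 r : Cmod z = 1%R -> nonpole v -> (0 < r)%R ->
  exists B, forall j,
    Wnorm_le s0 r (B * exp ((- Re s0 + r) * ln (INR j + 1)))%R (fun s => lerch_term z s v j).
Proof.
  intros Hz Hv Hr. destruct (shift_log_growth v Hv) as [B [HB0 HB]].
  exists (exp (Rabs (Re s0) * B + Rabs (Im s0) * PI + r * B)). intros j.
  destruct (HB j) as [Hre Hmod].
  assert (HW : Wnorm_le s0 r (exp (r * Cmod (shift_log v j)))
                 (fun s => Cexp (- shift_log v j * (s - s0)))).
  { apply Wnorm_exp; [assumption|].
    replace (r * Cmod (shift_log v j))%R with (Cmod (- shift_log v j) * (r * Cmod 1))%R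
      by (rewrite Cmod_opp, Cmod_1; ring).
    apply (Wnorm_scal s0 r _ _ (fun s => s - s0)).
    apply Wnorm_ext with (h := fun s => (s - s0) * 1); [intros; ring|].
    apply Wnorm_shift; [lra|]. apply Wnorm_const. lra. }
  apply Wnorm_ext with (h := fun s =>
    (Cexp (- s0 * shift_log v j) * z ^ j) * Cexp (- shift_log v j * (s - s0))).
  { intros s _. rewrite lerch_term_exp.
    replace (- s * shift_log v j) with (- s0 * shift_log v j + - shift_log v j * (s - s0)) by ring.
    rewrite Cexp_plus. ring. }
  apply Wnorm_weaken with (3 := Wnorm_scal _ _ _ _ _ HW); [lra|].
  rewrite Cmod_mult, Cmod_pow, Hz, pow1, Rmult_1_r, Cmod_Cexp, <- !exp_plus.
  apply exp_mono.
  set (L := ln (INR j + 1)) in *.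
  assert (E : Re (- s0 * shift_log v j) =
    (- Re s0 * L + - Re s0 * (Re (shift_log v j) - L) + Im s0 * Im (shift_log v j))%R).
  { destruct s0 as [a b], (shift_log v j) as [p q]. simpl. ring. }
  rewrite E.
  assert (H1 : (- Re s0 * (Re (shift_log v j) - L) <= Rabs (Re s0) * B)%R).
  { eapply Rle_trans; [apply Rle_abs|]. rewrite Rabs_mult, Rabs_Ropp.
    apply Rmult_le_compat_l; [apply Rabs_pos|assumption]. }
  assert (H2 : (Im s0 * Im (shift_log v j) <= Rabs (Im s0) * PI)%R).
  { eapply Rle_trans; [apply Rle_abs|]. rewrite Rabs_mult.
    apply Rmult_le_compat_l; [apply Rabs_pos|]. apply Carg_bound. }
  assert (H3 : (r * Cmod (shift_log v j) <= r * (L + B))%R) by (apply Rmult_le_compat_l; lra).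
  lra.
Qed.

(** Weights of order [j^(- N)] move the half-plane of absolute convergence by
    [N] to the left. *)
Lemma analytic_weighted_lerch_series z v N rho : Cmod z = 1%R -> nonpole v -> bigO N rho ->
  exists H : C -> C, forall s, (1 - INR N < Re s)%R ->
    C_analytic_at H s /\ Cseries (fun j => lerch_term z s v j * rho j s) (H s).
Proof.
  intros Hz Hv Hrho.
  assert (Hloc : forall s0, (1 - INR N < Re s0)%R ->
    let r := ((Re s0 - 1 + INR N) / 2)%R in (0 < r)%R /\
    exists M : nat -> R, ex_series M /\
      forall j, Wnorm_le s0 r (M j) (fun s => lerch_term z s v j * rho j s)).
  { intros s0 Hs0 r. assert (Hr : (0 < r)%R) by (unfold r; lra). split; [assumption|].
    destruct (lerch_term_Wnorm z v s0 r Hz Hv Hr) as [B1 H1].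
    destruct (Hrho s0 r Hr) as [B2 H2].
    exists (fun j => (B1 * B2) * exp (- (Re s0 - r + INR N) * ln (INR j + 1)))%R. split.
    - apply (ex_series_scal_l (K := R_AbsRing) (V := R_NormedModule) (B1 * B2)%R).
      apply ex_series_recip. unfold r. lra.
    - intros j.
      replace ((B1 * B2) * exp (- (Re s0 - r + INR N) * ln (INR j + 1)))%R
        with ((B1 * exp ((- Re s0 + r) * ln (INR j + 1))) * (B2 * recip j ^ N))%R.
      + now apply Wnorm_mult.
      + rewrite recip_pow_exp.
        replace (- (Re s0 - r + INR N) * ln (INR j + 1))%R
          with ((- Re s0 + r) * ln (INR j + 1) + - INR N * ln (INR j + 1))%R by ring.
        rewrite exp_plus. ring. }
  assert (Hex : forall s, exists l : C, (1 - INR N < Re s)%R ->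
    Cseries (fun j => lerch_term z s v j * rho j s) l).
  { intros s. destruct (Rlt_dec (1 - INR N) (Re s)) as [Hs|Hs]; [|exists (RtoC 0); contradiction].
    destruct (Hloc s Hs) as [Hr [M [HM HW]]].
    destruct (ex_Cseries_le (fun j => lerch_term z s v j * rho j s) M) as [l Hl];
      [|assumption|now exists l].
    intros j. apply (Wnorm_bound _ _ _ _ s (HW j)).
    replace (s - s) with (RtoC 0) by ring. rewrite Cmod_0. assumption. }
  destruct (choose_function _ Hex) as [H HH]. exists H. intros s0 Hs0.
  split; [|now apply HH].
  destruct (Hloc s0 Hs0) as [Hr [M [HM HW]]].
  apply (Wnorm_analytic s0 _ (Series M) H Hr).
  apply (Wnorm_series s0 _ M _ H Hr HW HM).
  intros s Hs. apply HH.
  pose proof (re_le_Cmod (s - s0)) as Hre. apply Rabs_le_between in Hre.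
  assert (E : Re (s - s0) = (Re s - Re s0)%R) by (destruct s, s0; reflexivity).
  rewrite E in Hre. lra.
Qed.

Lemma lerch_term_add z s v n j : nonpole v ->
  lerch_term z (s + INR n) v j = lerch_term z s v j * (/ (v + INR j)) ^ n.
Proof.
  intros Hv. rewrite !lerch_term_exp, <- (Cexp_shift_log v j Hv), <- Cexp_opp, <- Cexp_mult_INR.
  replace (- (s + INR n) * shift_log v j)
    with (- s * shift_log v j + INR n * - shift_log v j) by ring.
  rewrite Cexp_plus. ring.
Qed.

Lemma lerch_term_succ z s v j :
  lerch_term z s v (S j) = z * (lerch_term z s v j * Cexp (- s * log_step v j)).
Proof.
  rewrite !lerch_term_exp. unfold log_step.
  replace (- s * shift_log v (S j)) with
    (- s * shift_log v j + - s * (shift_log v (S j) - shift_log v j)) by ring.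
  rewrite Cexp_plus. simpl. ring.
Qed.

(** The terms of index [j + 1] are [z] times those of index [j] times
    [(1 + / (v + INR j))^(- s)].  Expanding this power and observing that a
    factor [/ (v + INR j)] turns the term for [s] into the one for [s + 1]
    expresses the difference through Lerch series with larger [s], up to a sum
    that converges further to the left. *)
Lemma lerch_difference_sum z v K : Cmod z = 1%R -> nonpole v ->
  exists H : C -> C, forall s, (- INR K - 1 < Re s)%R ->
    C_analytic_at H s /\
    Cseries (fun j => lerch_term z s v (S j) - z * lerch_term z s v j
      - z * Csum (fun n => negbinom (S n) s * lerch_term z (s + INR (S n)) v j) K) (H s).
Proof.
  intros Hz Hv.
  destruct (log_step_bound v Hv) as [B HB].
  pose proof (newton_expansion (fun j => / (v + INR j)) (log_step v) B (S K)
                HB (fun j => Cexp_log_step v j Hv)) as Hexp.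
  destruct (analytic_weighted_lerch_series z v (S (S K)) _ Hz Hv Hexp) as [H0 HH0].
  exists (fun s => z * H0 s). intros s Hs.
  destruct (HH0 s) as [Ha Hser]; [rewrite !S_INR; lra|].
  split; [now apply analytic_scal|].
  apply Cseries_ext with (2 := Cseries_scal z _ _ Hser). intros j.
  rewrite lerch_term_succ, Csum_head.
  rewrite (Csum_ext (fun n => negbinom (S n) s * lerch_term z (s + INR (S n)) v j)
    (fun n => lerch_term z s v j * (negbinom (S n) s * (/ (v + INR j)) ^ S n))).
  - rewrite Csum_scal. simpl. ring.
  - intros n _. rewrite lerch_term_add by assumption. ring.
Qed.

Lemma lerch_term_tends_to_0 z v s : Cmod z = 1%R -> nonpole v -> (0 < Re s)%R ->
  forall eps, (0 < eps)%R -> exists J, forall j, (J <= j)%nat -> (Cmod (lerch_term z s v j) < eps)%R.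
Proof.
  intros Hz Hv Hs eps Heps.
  destruct (lerch_term_Wnorm z v s (Re s / 2) Hz Hv ltac:(lra)) as [B HB].
  assert (HB0 : (0 <= B)%R).
  { pose proof (Wnorm_ge_0 _ _ _ _ (HB 0%nat)). pose proof (exp_pos ((- Re s + Re s / 2) * ln (INR 0 + 1))). nra. }
  destruct (far_index (exp (2 / Re s * ln ((B + 1) / eps)))) as [J HJ].
  exists J. intros j Hj. specialize (HJ j Hj).
  assert (Hb : (Cmod (lerch_term z s v j) <= B * exp ((- Re s + Re s / 2) * ln (INR j + 1)))%R).
  { apply (Wnorm_bound _ _ _ _ s (HB j)).
    replace (s - s) with (RtoC 0) by ring. rewrite Cmod_0. lra. }
  assert (Hpos : (0 < (B + 1) / eps)%R) by (apply Rdiv_lt_0_compat; lra).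
  assert (HL : (2 / Re s * ln ((B + 1) / eps) <= ln (INR j + 1))%R).
  { rewrite <- (ln_exp (2 / Re s * ln ((B + 1) / eps))). apply ln_le; [apply exp_pos|lra]. }
  eapply Rle_lt_trans; [exact Hb|].
  assert (He : (exp ((- Re s + Re s / 2) * ln (INR j + 1)) <= eps / (B + 1))%R).
  { replace (eps / (B + 1))%R with (exp (- ln ((B + 1) / eps))).
    - apply exp_mono.
      apply (Rmult_le_compat_l (Re s / 2)) in HL; [|lra].
      replace (Re s / 2 * (2 / Re s * ln ((B + 1) / eps)))%R with (ln ((B + 1) / eps)) in HL by (field; lra).
      lra.
    - rewrite exp_Ropp, exp_ln by assumption. field. lra. }
  apply Rle_lt_trans with (B * (eps / (B + 1)))%R; [now apply Rmult_le_compat_l|].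
  unfold Rdiv. rewrite <- Rmult_assoc. apply Rlt_div_l; [lra|nra].
Qed.

Lemma Cseries_drop_first (a : nat -> C) l :
  Cseries a l -> Cseries (fun j => a (S j)) (l - a 0%nat).
Proof.
  intros H. apply (@is_series_incr_1 C_AbsRing C_NormedModule).
  assert (E : l - a 0%nat + a 0%nat = l) by ring.
  change (Cseries a (l - a 0%nat + a 0%nat)). now rewrite E.
Qed.

Lemma lerch_series z v : Cmod z = 1%R -> nonpole v ->
  exists F : C -> C, forall s, (1 < Re s)%R ->
    C_analytic_at F s /\ Cseries (lerch_term z s v) (F s).
Proof.
  intros Hz Hv.
  destruct (analytic_weighted_lerch_series z v 0 (fun _ _ => 1) Hz Hv) as [F HF].
  - apply bigO_entire, entire_const.
  - exists F. intros s Hs. destruct (HF s) as [H1 H2]; [simpl; lra|].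
    split; [assumption|]. apply Cseries_ext with (2 := H2). intros; ring.
Qed.

Lemma lerch_term0_entire z v : entire (fun s => lerch_term z s v 0).
Proof.
  apply (entire_mult (fun s => Cexp (- s * shift_log v 0)) (fun _ => z ^ 0)); [|apply entire_const].
  apply entire_exp. apply (entire_mult (fun s => - s)); [|apply entire_const].
  apply (entire_opp (fun s => s)), entire_id.
Qed.

Lemma Re_plus_INR s n : Re (s + INR n) = (Re s + INR n)%R.
Proof. destruct s. reflexivity. Qed.

(** For [z <> 1], the sum of the differences is [(1 - z) F s] minus the initial
    term, so [F s] is expressed by the values [F (s + n)] with [n > 0], already
    available, and by a function analytic on a strip of width 1 more. *)
Lemma strip_continuation_neq1 z v N : Cmod z = 1%R -> z <> 1 -> nonpole v ->
  exists F : C -> C,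
    (forall s, (1 < Re s)%R -> Cseries (lerch_term z s v) (F s)) /\
    (forall s, (1 - INR N < Re s)%R -> C_analytic_at F s).
Proof.
  intros Hz Hz1 Hv.
  assert (Hz1' : 1 - z <> 0).
  { intros E. apply Hz1. replace z with (1 - (1 - z)) by ring. rewrite E. ring. }
  induction N as [|N [F [HF1 HF2]]].
  - destruct (lerch_series z v Hz Hv) as [F HF]. exists F.
    split; intros s Hs; apply HF; [assumption|simpl in Hs; lra].
  - destruct (lerch_difference_sum z v N Hz Hv) as [H HH].
    exists (fun s => / (1 - z) * (lerch_term z s v 0 + H s +
      z * Csum (fun n => negbinom (S n) s * F (s + INR (S n))) N)).
    split.
    + intros s Hs. destruct (HH s) as [_ Hser]; [pose proof (pos_INR N); lra|].
      assert (Hsum : Cseries (fun j =>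
          Csum (fun n => negbinom (S n) s * lerch_term z (s + INR (S n)) v j) N)
          (Csum (fun n => negbinom (S n) s * F (s + INR (S n))) N)).
      { apply (Cseries_Csum (fun j n => negbinom (S n) s * lerch_term z (s + INR (S n)) v j)).
        intros n. apply Cseries_scal, HF1. rewrite Re_plus_INR. pose proof (pos_INR (S n)). lra. }
      pose proof (HF1 s Hs) as HFs.
      assert (E : H s = (F s - lerch_term z s v 0) - z * F s
        - z * Csum (fun n => negbinom (S n) s * F (s + INR (S n))) N).
      { apply Cseries_unique with (1 := Hser).
        apply Cseries_minus; [|now apply Cseries_scal].
        apply Cseries_minus; [now apply Cseries_drop_first|now apply Cseries_scal]. }
      rewrite E.
      match goal with |- Cseries _ ?l => replace l with (F s) by (field; assumption) end.
      assumption.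
    + intros s Hs. rewrite S_INR in Hs.
      apply analytic_scal. apply analytic_plus; [apply analytic_plus|].
      * apply entire_analytic, lerch_term0_entire.
      * apply HH. lra.
      * apply analytic_scal.
        apply (analytic_Csum (fun n s => negbinom (S n) s * F (s + INR (S n)))).
        intros n. apply analytic_mult; [apply entire_analytic, negbinom_entire|].
        apply (analytic_translate F). apply HF2. rewrite Re_plus_INR, S_INR.
        pose proof (pos_INR n). lra.
Qed.

Lemma Cseries_telescope (a : nat -> C) :
  (forall eps, (0 < eps)%R -> exists J, forall j, (J <= j)%nat -> (Cmod (a j) < eps)%R) ->
  Cseries (fun j => a (S j) - a j) (- a 0%nat).
Proof.
  intros H. apply Cseries_eps. intros eps Heps. destruct (H eps Heps) as [J HJ].
  exists J. intros n Hn.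
  assert (E : Csum (fun j => a (S j) - a j) n = a (S n) - a 0%nat :> C).
  { clear. induction n as [|n IH]; rewrite ?Csum_S, ?Csum_0, ?IH; ring. }
  rewrite E. replace (a (S n) - a 0%nat - - a 0%nat) with (a (S n)) by ring.
  apply HJ. lia.
Qed.

(** The factor [s + INR n - 1] cancels the pole of the zeta function at 1, met
    at the argument [s + INR n]. *)
Lemma negbinom_S_pred n s :
  negbinom (S n) (s - 1) = - (/ INR (S n))%R * (negbinom n (s - 1) * (s + INR n - 1)).
Proof.
  change (negbinom (S n) (s - 1)) with (negbinom n (s - 1) * ((- (s - 1) - INR n) * (/ INR (S n))%R)).
  ring.
Qed.

(** For [z = 1] the coefficient of [F s] vanishes, and the relation taken at
    [s - 1] determines [G s = (s - 1) F s].  Each [F (s + n)] could contribute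
    a pole at [s = 1 - n], but the coefficient [negbinom (S n) (s - 1)] contains
    the factor [s + n - 1]: everything can be written in terms of [G], which
    therefore continues without any singularity. *)
Lemma strip_continuation_1 v N : nonpole v ->
  exists G : C -> C,
    (forall s, (1 < Re s)%R -> exists l : C, Cseries (lerch_term 1 s v) l /\ G s = (s - 1) * l) /\
    (forall s, (1 - INR N < Re s)%R -> C_analytic_at G s).
Proof.
  intros Hv. pose proof Cmod_1 as Hz.
  induction N as [|N [G [HG1 HG2]]].
  - destruct (lerch_series 1 v Hz Hv) as [F HF]. exists (fun s => (s - 1) * F s). split.
    + intros s Hs. exists (F s). split; [now apply HF|reflexivity].
    + intros s Hs. simpl in Hs.
      apply (analytic_mult (fun s => s - 1)); [|apply HF; lra].
      apply analytic_minus; apply entire_analytic; [apply entire_id|apply entire_const].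
  - destruct (lerch_difference_sum 1 v (S N) Hz Hv) as [H HH].
    destruct (lerch_series 1 v Hz Hv) as [F HF].
    exists (fun s => lerch_term 1 (s - 1) v 0 + H (s - 1)
      + - (1) * Csum (fun m => (/ INR (S (S m)))%R * (negbinom (S m) (s - 1) * G (s + INR (S m)))) N).
    split.
    + intros s Hs. exists (F s). split; [now apply HF|].
      assert (Hs1 : Re (s - 1) = (Re s - 1)%R) by (destruct s; reflexivity).
      destruct (HH (s - 1)) as [_ Hser]; [rewrite Hs1; pose proof (pos_INR (S N)); lra|].
      assert (HGF : forall n, G (s + INR n) = (s + INR n - 1) * F (s + INR n)).
      { intros n. assert (Hsn : (1 < Re (s + INR n))%R) by (rewrite Re_plus_INR; pose proof (pos_INR n); lra).
        destruct (HG1 _ Hsn) as [l [Hl ->]].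
        now rewrite (Cseries_unique _ _ _ Hl (proj2 (HF _ Hsn))). }
      assert (Hsum : Cseries (fun j =>
          Csum (fun n => negbinom (S n) (s - 1) * lerch_term 1 (s - 1 + INR (S n)) v j) (S N))
          (Csum (fun n => negbinom (S n) (s - 1) * F (s + INR n)) (S N))).
      { apply (Cseries_Csum (fun j n => negbinom (S n) (s - 1) * lerch_term 1 (s - 1 + INR (S n)) v j)).
        intros n. apply Cseries_scal.
        replace (s - 1 + INR (S n)) with (s + INR n) by (rewrite S_INR, RtoC_plus; ring).
        apply HF. rewrite Re_plus_INR. pose proof (pos_INR n). lra. }
      assert (E : H (s - 1) = - lerch_term 1 (s - 1) v 0
        - 1 * Csum (fun n => negbinom (S n) (s - 1) * F (s + INR n)) (S N)).
      { apply Cseries_unique with (1 := Hser).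
        apply Cseries_minus; [|now apply Cseries_scal].
        apply Cseries_ext with (fun j => lerch_term 1 (s - 1) v (S j) - lerch_term 1 (s - 1) v j).
        { intros; ring. }
        apply Cseries_telescope. apply lerch_term_tends_to_0; [assumption|assumption|].
        rewrite Hs1. lra. }
      rewrite E, Csum_head.
      rewrite (Csum_ext (fun i => negbinom (S (S i)) (s - 1) * F (s + INR (S i)))
        (fun m => - ((/ INR (S (S m)))%R * (negbinom (S m) (s - 1) * G (s + INR (S m)))))).
      * rewrite Csum_opp. simpl negbinom. simpl INR.
        replace (s + 0) with s by ring. rewrite Rinv_1. ring.
      * intros m _. rewrite HGF, negbinom_S_pred. ring.
    + intros s Hs. rewrite S_INR in Hs.
      assert (Hs1 : Re (s - 1) = (Re s - 1)%R) by (destruct s; reflexivity).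
      apply analytic_plus; [apply analytic_plus|].
      * apply (analytic_translate (fun s => lerch_term 1 s v 0) s (- (1))).
        apply entire_analytic, lerch_term0_entire.
      * apply (analytic_translate H s (- (1))). apply HH.
        change (s + - (1)) with (s - 1). rewrite Hs1, S_INR. lra.
      * apply analytic_scal.
        apply (analytic_Csum (fun m s => (/ INR (S (S m)))%R * (negbinom (S m) (s - 1) * G (s + INR (S m))))).
        intros m. apply analytic_scal, analytic_mult.
        -- apply (analytic_translate (negbinom (S m)) s (- (1))). apply entire_analytic, negbinom_entire.
        -- apply (analytic_translate G). apply HG2. rewrite Re_plus_INR, S_INR.
           pose proof (pos_INR m). lra.
Qed.

Lemma strip_continuation z v N : Cmod z = 1%R -> nonpole v ->
  exists F : C -> C,
    (forall s, (1 < Re s)%R -> Cseries (lerch_term z s v) (F s)) /\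
    (forall s, (1 - INR N < Re s)%R -> ~ (z = 1 /\ s = 1) -> C_analytic_at F s).
Proof.
  intros Hz Hv. destruct (excluded_middle_informative (z = 1)) as [->|Hz1].
  - destruct (strip_continuation_1 v N Hv) as [G [HG1 HG2]].
    exists (fun s => / (s - 1) * G s). split.
    + intros s Hs. destruct (HG1 s Hs) as [l [Hl ->]].
      replace (/ (s - 1) * ((s - 1) * l)) with l; [assumption|].
      field. intros E. assert (s = 1) by (replace s with (s - 1 + 1) by ring; rewrite E; ring).
      subst s. simpl in Hs. lra.
    + intros s Hs Hne. apply (analytic_mult (fun s => / (s - 1))); [|now apply HG2].
      apply analytic_inv. auto.
  - destruct (strip_continuation_neq1 z v N Hz Hz1 Hv) as [F [HF1 HF2]].
    exists F. split; auto.
Qed.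

(** The difference vanishes for [Re s > 1], so the identity theorem applies; [z]
    only records whether the point 1 is a singularity. *)
Lemma continuation_agree (z : C) (F G : C -> C) (sigma : R) :
  (forall s, (1 < Re s)%R -> F s = G s) ->
  (forall s, (sigma < Re s)%R -> ~ (z = 1 /\ s = 1) -> C_analytic_at F s) ->
  (forall s, (sigma < Re s)%R -> ~ (z = 1 /\ s = 1) -> C_analytic_at G s) ->
  forall s, (sigma < Re s)%R -> ~ (z = 1 /\ s = 1) -> F s = G s.
Proof.
  intros E HF HG s Hs Hne.
  assert (H : F s - G s = 0).
  { apply (identity_halfplane (fun u => F u - G u)).
    - intros u Hu. rewrite E by assumption. ring.
    - intros u Hu Hu1. assert (~ (z = 1 /\ u = 1)) by tauto.
      apply analytic_minus; [apply HF|apply HG]; auto; lra. }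
  replace (F s) with (F s - G s + G s) by ring. rewrite H. ring.
Qed.

(** The continuations to the half-planes [Re s > 1 - N] agree with one another
    by uniqueness, so at each [s] any [N] that is large enough may be used. *)
Lemma lerch_continuation_exists z v : Cmod z = 1%R -> nonpole v ->
  exists F, is_lerch_continuation z v F.
Proof.
  intros Hz Hv.
  destruct (choose_function _ (fun N => strip_continuation z v N Hz Hv)) as [F HF].
  assert (Hagree : forall M N s, (M <= N)%nat -> (1 - INR M < Re s)%R -> ~ (z = 1 /\ s = 1) ->
    F M s = F N s).
  { intros M N s HMN. apply le_INR in HMN.
    apply (continuation_agree z (F M) (F N) (1 - INR M)).
    - intros u Hu. apply (Cseries_unique (lerch_term z u v)); now apply HF.
    - intros u Hu. now apply (HF M).
    - intros u Hu. apply (HF N). lra. }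
  assert (Hidx : forall s : C, exists N, (1 - INR N < Re s)%R).
  { intros s. destruct (INR_unbounded (1 - Re s)) as [N HN]. exists N. lra. }
  destruct (choose_function _ Hidx) as [idx Hx].
  exists (fun s => F (idx s) s). split.
  - intros s Hs. now apply HF.
  (* One unit of margin keeps a disc of radius 1 in the half-plane of [F N]. *)
  - intros s Hne. set (N := S (idx s)).
    assert (HN : (1 - INR N < Re s - 1)%R) by (unfold N; rewrite S_INR; specialize (Hx s); lra).
    (* For [z = 1] the disc must also avoid the singularity. *)
    assert (Hrho : exists rho, (0 < rho <= 1)%R /\
      forall u, (Cmod (u - s) < rho)%R -> ~ (z = 1 /\ u = 1)).
    { destruct (excluded_middle_informative (z = 1)) as [Hz1|Hz1].
      - assert (Hd : (0 < Cmod (1 - s))%R).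
        { apply Cmod_gt_0. intros E. apply Hne. split; [assumption|].
          replace s with (1 - (1 - s)) by ring. rewrite E. ring. }
        exists (Rmin 1 (Cmod (1 - s))). split.
        + split; [apply Rmin_glb_lt; lra|apply Rmin_l].
        + intros u Hu [_ ->]. pose proof (Rmin_r 1 (Cmod (1 - s))). lra.
      - exists 1%R. split; [lra|]. tauto. }
    destruct Hrho as [rho [Hrho Hu1]].
    apply analytic_local with (F := F N) (rho := rho).
    + lra.
    + intros u Hu. specialize (Hu1 u Hu).
      assert (HuN : (1 - INR N < Re u)%R).
      { pose proof (re_le_Cmod (u - s)) as Hre. apply Rabs_le_between in Hre.
        assert (E : Re (u - s) = (Re u - Re s)%R) by (destruct u, s; reflexivity).
        rewrite E in Hre. lra. }
      destruct (Nat.le_ge_cases N (idx u)) as [Hle|Hle].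
      * now apply Hagree.
      * symmetry. apply Hagree; [assumption|apply Hx|assumption].
    + apply HF; [lra|assumption].
Qed.

(** * Trisection of the Lerch function *)

Lemma ex_series_poly_geom (A q : R) : (0 < q < 1)%R -> (0 <= A)%R ->
  ex_series (fun j => exp (A * ln (INR j + 1)) * q ^ j)%R.
Proof.
  intros Hq HA.
  assert (Hlq : (ln q < 0)%R) by (rewrite <- ln_1; apply ln_increasing; lra).
  (* The tangent to [ln] at [c] is the one for which [(A + 2) * ln y] is
     dominated by [- y * ln q]; this leaves a factor [(j + 1)^(- 2)]. *)
  set (c := ((A + 2) / - ln q)%R).
  assert (Hc : (0 < c)%R) by (apply Rdiv_lt_0_compat; lra).
  set (M := exp ((A + 2) * (ln c - 1) - ln q)).
  apply (@ex_series_le R_AbsRing R_CompleteNormedModule _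
           (fun j => M * exp (- 2 * ln (INR j + 1)))%R).
  - intros j. change (Rabs (exp (A * ln (INR j + 1)) * q ^ j) <= M * exp (- 2 * ln (INR j + 1)))%R.
    rewrite Rabs_pos_eq by (apply Rmult_le_pos; [apply Rlt_le, exp_pos|apply pow_le; lra]).
    replace (q ^ j)%R with (exp (INR j * ln q)).
    2:{ rewrite <- Rpower_pow by lra. reflexivity. }
    unfold M. rewrite <- !exp_plus. apply exp_mono.
    pose proof (pos_INR j) as Hj. set (y := (INR j + 1)%R).
    assert (Hy : (0 < y)%R) by (unfold y; lra).
    assert (Hln : (ln y <= ln c + y / c - 1)%R).
    { pose proof (exp_ineq1_le (ln (y / c))) as E.
      rewrite exp_ln in E by now apply Rdiv_lt_0_compat. rewrite ln_div in E by assumption. lra. }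
    apply (Rmult_le_compat_l (A + 2)) in Hln; [|lra].
    replace ((A + 2) * (ln c + y / c - 1))%R
      with ((A + 2) * (ln c - 1) - (INR j + 1) * ln q)%R in Hln.
    + lra.
    + unfold y, c. field. split; lra.
  - apply (ex_series_scal_l (K := R_AbsRing) (V := R_NormedModule) M). exact (ex_series_recip 2 ltac:(lra)).
Qed.

Lemma ex_lerch_series_inside (z s v : C) : z <> 0 -> (Cmod z < 1)%R -> nonpole v ->
  exists l : C, Cseries (lerch_term z s v) l.
Proof.
  intros Hz0 Hz Hv. apply Cmod_gt_0 in Hz0.
  destruct (shift_log_growth v Hv) as [B [HB0 HB]].
  apply ex_Cseries_le with (fun j =>
    exp (Cmod s * B) * (exp (Cmod s * ln (INR j + 1)) * Cmod z ^ j))%R.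
  - intros j. destruct (HB j) as [_ Hb].
    rewrite lerch_term_exp, Cmod_mult, Cmod_pow, Cmod_Cexp, <- Rmult_assoc, <- exp_plus.
    apply Rmult_le_compat_r; [apply pow_le, Cmod_ge_0|]. apply exp_mono.
    eapply Rle_trans; [apply Rle_abs|]. eapply Rle_trans; [apply re_le_Cmod|].
    rewrite Cmod_mult, Cmod_opp. pose proof (Cmod_ge_0 s).
    rewrite <- Rmult_plus_distr_l. apply Rmult_le_compat_l; lra.
  - apply (ex_series_scal_l (K := R_AbsRing) (V := R_NormedModule) (exp (Cmod s * B))).
    apply ex_series_poly_geom; [lra|apply Cmod_ge_0].
Qed.

Lemma HurwitzLerch_inside (z s v : C) : z <> 0 -> (Cmod z < 1)%R -> nonpole v ->
  Cseries (lerch_term z s v) (HurwitzLerch z s v).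
Proof.
  intros Hz0 Hz Hv. unfold HurwitzLerch. destruct Rlt_dec; [|contradiction].
  apply (iota_correct (V := C_CompleteNormedModule)
    (fun w => @is_series C_AbsRing C_NormedModule (lerch_term z s v) w)).
  destruct (ex_lerch_series_inside z s v Hz0 Hz Hv) as [l Hl].
  exists l. split; [assumption|]. intros y Hy. exact (Cseries_unique _ _ _ Hl Hy).
Qed.

Lemma HurwitzLerch_boundary (z s v : C) (F : C -> C) : Cmod z = 1%R ->
  ~ (z = 1 /\ s = 1) -> is_lerch_continuation z v F -> HurwitzLerch z s v = F s.
Proof.
  intros Hz Hs HF. unfold HurwitzLerch. destruct Rlt_dec as [H|_]; [lra|].
  apply (iota_unique (V := C_CompleteNormedModule)
    (fun w => exists F : C -> C, is_lerch_continuation z v F /\ w = F s)).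
  - intros y [G [HG ->]].
    apply (continuation_agree z G F (Re s - 1)).
    + intros u Hu. apply (Cseries_unique (lerch_term z u v)); [now apply HG|now apply HF].
    + intros u _. apply HG.
    + intros u _. apply HF.
    + lra.
    + assumption.
  - now exists F.
Qed.

Lemma Cseries_mod3 (a : nat -> C) (L l0 l1 l2 : C) :
  Cseries a L ->
  Cseries (fun j => a (3 * j)%nat) l0 ->
  Cseries (fun j => a (3 * j + 1)%nat) l1 ->
  Cseries (fun j => a (3 * j + 2)%nat) l2 ->
  L = l0 + l1 + l2.
Proof.
  intros HL H0 H1 H2.
  apply (Cseries_unique (fun j => a (3 * j)%nat + a (3 * j + 1)%nat + a (3 * j + 2)%nat)).
  2:{ repeat apply Cseries_plus; assumption. }
  apply Cseries_eps. intros eps Heps.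
  destruct (proj1 (Cseries_eps a L) HL eps Heps) as [N HN].
  exists N. intros n Hn.
  assert (E : Csum (fun j => a (3 * j)%nat + a (3 * j + 1)%nat + a (3 * j + 2)%nat) n
     = Csum a (3 * n + 2) :> C).
  { clear. induction n as [|n IH].
    - rewrite Csum_0. change (3 * 0 + 2)%nat with 2%nat. rewrite !Csum_S, Csum_0. reflexivity.
    - rewrite Csum_S, IH.
      replace (3 * S n + 2)%nat with (S (S (S (3 * n + 2)))) by lia. rewrite !Csum_S.
      replace (3 * S n)%nat with (S (3 * n + 2)) by lia.
      replace (S (3 * n + 2) + 1)%nat with (S (S (3 * n + 2))) by lia.
      replace (S (3 * n + 2) + 2)%nat with (S (S (S (3 * n + 2)))) by lia. ring. }
  rewrite E. apply HN. lia.
Qed.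

Lemma RtoC_3_neq_0 : RtoC 3 <> 0.
Proof. intros E. injection E. lra. Qed.

Lemma nonpole_third (v : C) (r : nat) : nonpole v -> nonpole ((v + INR r) / 3).
Proof.
  intros Hv j E. pose proof RtoC_3_neq_0. apply (Hv (3 * j + r)%nat).
  replace v with (3 * ((v + INR r) / 3) - INR r) by (field; assumption).
  rewrite E, plus_INR, mult_INR, RtoC_plus, RtoC_mult. simpl (INR 3).
  replace (1 + 1 + 1)%R with 3%R by ring. ring.
Qed.

(** Since [v + (3 j + r) = 3 ((v + r) / 3 + j)], and a positive factor
    does not change the principal argument. *)
Lemma lerch_term_third (z s v : C) (r j : nat) : nonpole v ->
  lerch_term z s v (3 * j + r) =
  (Cexp (- s * ln 3) * z ^ r) * lerch_term (z ^ 3) s ((v + INR r) / 3) j.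
Proof.
  intros Hv. unfold lerch_term, Cpower. pose proof RtoC_3_neq_0.
  replace (v + INR (3 * j + r)) with (3 * ((v + INR r) / 3 + INR j)).
  - rewrite Clog_scal; [|lra|now apply nonpole_neq_0, nonpole_third].
    rewrite Cmult_plus_distr_l, Cexp_plus, Cpow_add_r, Cpow_mult_r. ring.
  - rewrite plus_INR, mult_INR, RtoC_plus, RtoC_mult. simpl (INR 3).
    replace (1 + 1 + 1)%R with 3%R by ring. field.
Qed.

Lemma lerch_series_trisection (z s v : C) (L l0 l1 l2 : C) : nonpole v ->
  Cseries (lerch_term z s v) L ->
  Cseries (lerch_term (z ^ 3) s ((v + INR 0) / 3)) l0 ->
  Cseries (lerch_term (z ^ 3) s ((v + INR 1) / 3)) l1 ->
  Cseries (lerch_term (z ^ 3) s ((v + INR 2) / 3)) l2 ->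
  L = Cexp (- s * ln 3) * (l0 + z * l1 + z ^ 2 * l2).
Proof.
  intros Hv HL H0 H1 H2.
  assert (Hr : forall r l, Cseries (lerch_term (z ^ 3) s ((v + INR r) / 3)) l ->
    Cseries (fun j => lerch_term z s v (3 * j + r)) (Cexp (- s * ln 3) * z ^ r * l)).
  { intros r l Hl. apply Cseries_ext with (2 := Cseries_scal _ _ _ Hl).
    intros j. now rewrite lerch_term_third. }
  rewrite (Cseries_mod3 (lerch_term z s v) L
    (Cexp (- s * ln 3) * z ^ 0 * l0) (Cexp (- s * ln 3) * z ^ 1 * l1)
    (Cexp (- s * ln 3) * z ^ 2 * l2)).
  - simpl. ring.
  - assumption.
  - apply Cseries_ext with (2 := Hr 0%nat l0 H0). intros j. now rewrite Nat.add_0_r.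
  - now apply Hr.
  - now apply Hr.
Qed.

(** Inside the disc this is a statement about convergent series.  On the circle
    both sides are analytic in [s] and agree for [Re s > 1], hence agree at
    every [s]; only for [z ^ 3 = 1] does [s = 1] have to be excluded. *)
Lemma HurwitzLerch_trisection (z s v : C) :
  z <> 0 -> (Cmod z <= 1)%R -> nonpole v -> ~ (z ^ 3 = 1 /\ s = 1) ->
  HurwitzLerch z s v = Cexp (- s * ln 3) *
    (HurwitzLerch (z ^ 3) s ((v + INR 0) / 3) + z * HurwitzLerch (z ^ 3) s ((v + INR 1) / 3)
     + z ^ 2 * HurwitzLerch (z ^ 3) s ((v + INR 2) / 3)).
Proof.
  intros Hz0 Hz Hv Hs.
  pose proof (Cpow_nz z 3 Hz0) as Hz30.
  pose proof (fun r => nonpole_third v r Hv) as Hvr.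
  destruct Hz as [Hlt|Heq].
  - assert (Hz3 : (Cmod (z ^ 3) < 1)%R).
    { rewrite Cmod_pow. pose proof (Cmod_ge_0 z). simpl. nra. }
    apply (lerch_series_trisection z s v); auto using HurwitzLerch_inside.
  - assert (Hz3 : Cmod (z ^ 3) = 1%R) by (rewrite Cmod_pow, Heq; apply pow1).
    assert (Hs' : forall u : C, ~ (z ^ 3 = 1 /\ u = 1) -> ~ (z = 1 /\ u = 1)).
    { intros u Hu [-> ->]. apply Hu. split; [apply Cpow_1_l|reflexivity]. }
    destruct (lerch_continuation_exists z v Heq Hv) as [F HF].
    destruct (lerch_continuation_exists (z ^ 3) _ Hz3 (Hvr 0%nat)) as [F0 HF0].
    destruct (lerch_continuation_exists (z ^ 3) _ Hz3 (Hvr 1%nat)) as [F1 HF1].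
    destruct (lerch_continuation_exists (z ^ 3) _ Hz3 (Hvr 2%nat)) as [F2 HF2].
    pose proof (Hs' s Hs) as Hs1.
    rewrite (HurwitzLerch_boundary z s v F), (HurwitzLerch_boundary _ s _ F0),
      (HurwitzLerch_boundary _ s _ F1), (HurwitzLerch_boundary _ s _ F2) by assumption.
    apply (continuation_agree (z ^ 3) F
      (fun u => Cexp (- u * ln 3) * (F0 u + z * F1 u + z ^ 2 * F2 u)) (Re s - 1));
      [| | |lra|assumption].
    + intros u Hu. apply lerch_series_trisection with (1 := Hv);
        [apply HF|apply HF0|apply HF1|apply HF2]; assumption.
    + intros u _ Hu. apply HF. auto.
    + intros u _ Hu. apply analytic_mult.
      * apply entire_analytic, entire_exp.
        apply (entire_mult (fun u => - u)); [|apply entire_const].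
        apply (entire_opp (fun s => s)), entire_id.
      * apply analytic_plus; [apply analytic_plus|]; [|apply analytic_scal..];
          [apply HF0|apply HF1|apply HF2]; assumption.
Qed.

(** * Telescoping *)

Lemma Cpower_scal (x : R) (w k : C) : (0 < x)%R -> w <> 0 ->
  Cpower (x * w) k = Cexp (k * ln x) * Cpower w k.
Proof.
  intros Hx Hw. unfold Cpower. rewrite Clog_scal by assumption.
  rewrite <- Cexp_plus. f_equal. ring.
Qed.

Lemma Cexp_cube (w : C) : Cexp (3 * w) = Cexp w ^ 3.
Proof.
  rewrite <- Cexp_mult_INR. simpl INR. now replace (1 + 1 + 1)%R with 3%R by ring.
Qed.

Lemma Csum_telescope (f A : nat -> C) n :
  (forall p, (p <= n)%nat -> f p = A p - A (S p)) -> Csum f n = A 0%nat - A (S n) :> C.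
Proof.
  intros H. induction n as [|n IH].
  - rewrite Csum_0. now apply H.
  - rewrite Csum_S, IH, H by (intros; try apply H; lia). ring.
Qed.

Lemma pow3_neq_0 p : (3 ^ p)%C <> 0.
Proof. apply Cpow_nz, RtoC_3_neq_0. Qed.

(** Level [p] of the telescoping: the first and third arguments of the Lerch
    function and the term attached to it.  Passing to level [p + 1] cubes the
    first argument and replaces the third one, [v], by [(v + 1) / 3], so the middle
    third of the trisection at level [p] is the term at level [p + 1]. *)
Definition nome (m : C) (p : nat) : C := Cexp (2 * Ci * 3 ^ p * m).

Definition level_shift (a : C) (p : nat) : C :=
  1 / 2 - 1 / 2 * Ci * / 3 ^ p * Clog a.

Definition level_value (k a m : C) (p : nat) : C :=
  Cpower (Ci * 3 ^ p) k * Cexp (Ci * m * 3 ^ p) *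
  HurwitzLerch (nome m p) (- k) (level_shift a p).

Lemma nome_succ m p : nome m (S p) = nome m p ^ 3.
Proof. unfold nome. rewrite <- Cexp_cube. f_equal. rewrite Cpow_S. ring. Qed.

Lemma Cmod_nome_le_1 m p : (0 <= Im m)%R -> (Cmod (nome m p) <= 1)%R.
Proof.
  intros hm. unfold nome. rewrite Cmod_Cexp, <- RtoC_pow, <- exp_0. apply exp_mono.
  destruct m as [x y]. simpl in *. pose proof (pow_lt 3 p ltac:(lra)). nra.
Qed.

Lemma two_neq_0 : RtoC 2 <> 0.
Proof. intros E. injection E. lra. Qed.

Lemma level_shift_succ a p : level_shift a (S p) = (level_shift a p + INR 1) / 3.
Proof.
  unfold level_shift. rewrite Cpow_S. pose proof (pow3_neq_0 p). pose proof RtoC_3_neq_0.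
  pose proof two_neq_0. simpl INR. field. auto.
Qed.

Lemma level_shift_nonpole a p : nonpole (level_shift a 0) -> nonpole (level_shift a p).
Proof.
  intros H. induction p as [|p IH]; [assumption|].
  rewrite level_shift_succ. now apply nonpole_third.
Qed.

(** With [E = Cexp (Ci * m * 3 ^ p)] the first argument at level [p] is [E ^ 2].
    The outer thirds of the trisection have the coefficients [E] and
    [E * E ^ 4] of the summand, and the middle one has [E * E ^ 2], which is the
    exponential factor of the next level. *)
Lemma summand_telescopes k a m p : (0 <= Im m)%R -> nonpole (level_shift a p) ->
  ~ (nome m (S p) = 1 /\ - k = 1) ->
  Cpower (Ci * 3 ^ (p + 1)) k * Cexp (Ci * m * 3 ^ p) *
    (HurwitzLerch (Cexp (2 * Ci * 3 ^ (p + 1) * m)) (- k)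
       (1 / 6 * (1 - Ci * / 3 ^ p * Clog a))
     + Cexp (4 * Ci * m * 3 ^ p) *
       HurwitzLerch (Cexp (2 * Ci * 3 ^ (p + 1) * m)) (- k)
         (1 / 6 * (5 - Ci * / 3 ^ p * Clog a)))
  = level_value k a m p - level_value k a m (S p).
Proof.
  intros hm HV Hk. rewrite nome_succ in Hk.
  pose proof (pow3_neq_0 p) as H3p. pose proof RtoC_3_neq_0 as H3. pose proof two_neq_0 as H2.
  assert (H6 : RtoC 6 <> 0) by (intros E; injection E; lra).
  rewrite Nat.add_1_r. unfold level_value at 1.
  rewrite (HurwitzLerch_trisection (nome m p));
    [|apply Cexp_neq_0|now apply Cmod_nome_le_1|assumption|assumption].
  unfold level_value. fold (nome m (S p)). rewrite nome_succ, level_shift_succ.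
  replace (1 / 6 * (1 - Ci * / 3 ^ p * Clog a)) with ((level_shift a p + INR 0) / 3).
  2:{ unfold level_shift. simpl INR. field_simplify_eq; [|repeat split; assumption]. ring. }
  replace (1 / 6 * (5 - Ci * / 3 ^ p * Clog a)) with ((level_shift a p + INR 2) / 3).
  2:{ unfold level_shift. simpl INR. replace (1 + 1)%R with 2%R by ring.
      field_simplify_eq; [|repeat split; assumption]. ring. }
  replace (Ci * 3 ^ S p) with (3 * (Ci * 3 ^ p)) by (rewrite Cpow_S; ring).
  rewrite Cpower_scal; [|lra|].
  2:{ intros E. apply (f_equal Cmod) in E. rewrite Cmod_mult, Cmod_Ci, Cmod_0, Rmult_1_l in E.
      apply Cmod_eq_0 in E. contradiction. }
  replace (- - k * ln 3) with (k * ln 3) by ring.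
  set (E := Cexp (Ci * m * 3 ^ p)).
  replace (Cexp (Ci * m * 3 ^ S p)) with (E ^ 3).
  2:{ unfold E. rewrite <- Cexp_cube. f_equal. rewrite Cpow_S. ring. }
  replace (Cexp (4 * Ci * m * 3 ^ p)) with (E ^ 4).
  2:{ unfold E. rewrite <- Cexp_mult_INR. f_equal. simpl INR.
      replace (1 + 1 + 1 + 1)%R with 4%R by ring. ring. }
  assert (EZ : nome m p = E ^ 2).
  { unfold E, nome. rewrite <- Cexp_mult_INR. f_equal. simpl INR.
    replace (1 + 1)%R with 2%R by ring. ring. }
  rewrite EZ. ring.
Qed.

Theorem theorem6p2 (n : nat) (k a m : C)
  (hn : (1 <= n)%nat) (ha : a <> 0) (hm : (0 <= Im m)%R)
  (hdef_sum : forall p : nat, (p < n)%nat ->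
     HurwitzLerch_defined (Cexp (2 * Ci * 3 ^ (p + 1) * m)) (- k)
       (1 / 6 * (1 - Ci * / 3 ^ p * Clog a)) /\
     HurwitzLerch_defined (Cexp (2 * Ci * 3 ^ (p + 1) * m)) (- k)
       (1 / 6 * (5 - Ci * / 3 ^ p * Clog a)))
  (hdef_0 : HurwitzLerch_defined (Cexp (2 * Ci * m)) (- k)
     (1 / 2 - 1 / 2 * Ci * Clog a))
  (hdef_n : HurwitzLerch_defined (Cexp (2 * Ci * 3 ^ n * m)) (- k)
     (1 / 2 - 1 / 2 * Ci * / 3 ^ n * Clog a)) :
  @sum_n C_AbelianMonoid
    (fun p : nat =>
       Cpower (Ci * 3 ^ (p + 1)) k * Cexp (Ci * m * 3 ^ p) *
       (HurwitzLerch (Cexp (2 * Ci * 3 ^ (p + 1) * m)) (- k)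
          (1 / 6 * (1 - Ci * / 3 ^ p * Clog a))
        + Cexp (4 * Ci * m * 3 ^ p) *
          HurwitzLerch (Cexp (2 * Ci * 3 ^ (p + 1) * m)) (- k)
            (1 / 6 * (5 - Ci * / 3 ^ p * Clog a))))
    (n - 1)
  = Cpower Ci k * Cexp (Ci * m) *
      HurwitzLerch (Cexp (2 * Ci * m)) (- k) (1 / 2 - 1 / 2 * Ci * Clog a)
    - Cpower (Ci * 3 ^ n) k * Cexp (Ci * m * 3 ^ n) *
      HurwitzLerch (Cexp (2 * Ci * 3 ^ n * m)) (- k)
        (1 / 2 - 1 / 2 * Ci * / 3 ^ n * Clog a).
Proof.
  destruct n as [|n]; [lia|]. rewrite Nat.sub_succ, Nat.sub_0_r.
  assert (E0 : 1 / 2 - 1 / 2 * Ci * Clog a = 1 / 2 - 1 / 2 * Ci * / 3 ^ 0 * Clog a).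
  { simpl. replace (/ RtoC 1) with (RtoC 1) by field. ring. }
  rewrite (Csum_telescope _ (level_value k a m)).
  - rewrite E0. unfold level_value, nome, level_shift. simpl (3 ^ 0).
    replace (Ci * 1) with Ci by ring. replace (Ci * m * 1) with (Ci * m) by ring.
    now replace (2 * Ci * 1 * m) with (2 * Ci * m) by ring.
  - intros p Hp. apply summand_telescopes.
    + assumption.
    + apply level_shift_nonpole. rewrite E0 in hdef_0. exact (proj1 hdef_0).
    + destruct (hdef_sum p ltac:(lia)) as [[_ H] _]. now rewrite Nat.add_1_r in H.
Qed.
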